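(* Let $W=\langle w_1,w_2,w_3\rangle$ be a $\mathbb{Z}_2$-graded complex vector space with $w_1$ odd and $w_2,w_3$ even, and let $d=\psi^{0,2,0}_1$. Then every nontrivial extension of $d$ (an extension not equivalent to $d$) is equivalent to a codifferential of the form $$d_e=\psi^{0,2,0}_1+\psi^{0,0,k}_1$$ for some integer $k>2$. Moreover, for every $k>2$, every extension of $d_e$ (that is, every codifferential of the form $d_e+\sum_{l>k}d_l$ with $d_l\in L_l$) is equivalent to $d_e$.
   Context: $S(W)=\bigoplus_{n\ge 1}S^n(W)$ is the ($\mathbb{Z}_2$-graded) symmetric coalgebra of $W$. Put $L_n=\mathrm{Hom}(S^n(W),W)$ and $L=\mathrm{Hom}(S(W),W)=\prod_{n\ge1}L_n$, identified with the space $\mathrm{Coder}(S(W))$ of coderivations of $S(W)$, a $\mathbb{Z}_2$-graded Lie algebra under the graded commutator $[\cdot,\cdot]$ of coderivations. Elements of $L_n$ have degree $n$. A codifferential is an odd element $d=d_1+d_2+\cdots\in L$, $d_i\in L_i$, with $[d,d]=0$. Its leading term is its first nonvanishing component $d_N$, and $d$ is then called an extension of $d_N$. For a multi-index $I=(i_1,i_2,i_3)$ with $i_1\in\{0,1\}$ and $i_2,i_3\ge 0$ let $w_I=w_1^{i_1}w_2^{i_2}w_3^{i_3}$, $|I|=i_1+i_2+i_3$, $I!=i_1!\,i_2!\,i_3!$. For $|I|=n$ define $\varphi^I_j\in L_n$ by $\varphi^I_j(w_J)=I!\,\delta^I_J\,w_j$. When $\varphi^I_j$ is odd it is written $\psi^I_j$.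 A coalgebra automorphism $g$ of $S(W)$ is determined by an even element $g_1+g_2+\cdots$ of $\mathrm{Hom}(S(W),W)$ with $g_i\in\mathrm{Hom}(S^i(W),W)$ and $g_1:W\to W$ invertible. Two codifferentials $d,d'$ are equivalent if $d'=g^*(d):=g^{-1}dg$ for some coalgebra automorphism $g$ of $S(W)$. *)

(* Defs.v *)
From HB Require Import structures.
From mathcomp Require Import all_boot all_order all_algebra.
From mathcomp Require Import reals finmap complex monalg.

Set Implicit Arguments.
Unset Strict Implicit.
Unset Printing Implicit Defensive.

Import Order.TTheory GRing.Theory Num.Theory.
Local Open Scope ring_scope.

Definition midx : Type := (nat * nat * nat)%type.

Definition mdeg (I : midx) : nat := (I.1.1 + I.1.2 + I.2)%N.

Definition madd (I J : midx) : midx :=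
  (I.1.1 + J.1.1, I.1.2 + J.1.2, I.2 + J.2)%N.

Definition msub (I J : midx) : midx :=
  (I.1.1 - J.1.1, I.1.2 - J.1.2, I.2 - J.2)%N.

Definition mfact (I : midx) : nat := (I.1.1`! * I.1.2`! * I.2`!)%N.

Definition mbin (I J : midx) : nat :=
  ('C(I.1.1, J.1.1) * 'C(I.1.2, J.1.2) * 'C(I.2, J.2))%N.

(* The multi-indices K <= J, componentwise. *)
Definition mbelow (J : midx) : seq midx :=
  [seq (ab, c) | ab <- [seq (a, b) | a <- iota 0 J.1.1.+1,
                                     b <- iota 0 J.1.2.+1],
                 c <- iota 0 J.2.+1].

(* The generators w_1, w_2, w_3 are indexed by 0, 1, 2 : 'I_3; munit j is the
   multi-index of the monomial w_(j+1). *)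
Definition munit (j : 'I_3) : midx :=
  (nat_of_bool (j == 0 :> nat), nat_of_bool (j == 1 :> nat),
   nat_of_bool (j == 2 :> nat)).

(* The multi-indices of the basis monomials of S(W): S(W) has no degree 0
   part, and w_1 ^ 2 = 0 since w_1 is odd. *)
Definition smon : choiceType :=
  [the choiceType of {I : midx | (I.1.1 <= 1) && (0 < mdeg I)}%N].
Definition smon2 : choiceType := [the choiceType of (smon * smon)%type].

(* Parities in Z/2, with true for odd. *)
Definition par_gen (j : 'I_3) : bool := j == 0 :> nat.
Definition par_mon (J : smon) : bool := odd (val J).1.1.

Section LinearExtension.
Variables (F : fieldType) (B : choiceType) (V : lmodType F) (f : B -> V).

Definition linext (x : {malg F[B]}) : V := \sum_(b <- msupp x) x@_b *: f b.

Lemma linextEw (A : {fset B}) x : (msupp x `<=` A)%fset ->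
  linext x = \sum_(b <- A) x@_b *: f b.
Proof.
move=> sxA; rewrite /linext; apply/(big_fset_incl _ sxA) => b _ bx.
by rewrite (mcoeff_outdom bx) scale0r.
Qed.

Lemma linext_is_linear : linear linext.
Proof.
move=> c x y; pose A := (msupp x `|` msupp y `|` msupp (c *: x + y))%fset.
rewrite !(@linextEw A) ?/A ?fsubsetUr //; last 2 first.
- by rewrite fsubsetU // fsubsetUr.
- by rewrite fsubsetU // fsubsetUl.
rewrite scaler_sumr -big_split /=; apply: eq_bigr => b _.
by rewrite mcoeffD mcoeffZ scalerDl scalerA.
Qed.

HB.instance Definition _ := GRing.isLinear.Build F {malg F[B]} V _ linext
  linext_is_linear.

Lemma linextU b : linext << b >> = f b.
Proof.
rewrite (@linextEw [fset b]%fset) ?msuppU_le // big_seq_fset1.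
by rewrite mcoeffU eqxx scale1r.
Qed.

End LinearExtension.

Section SymmetricCoalgebra.
Variable F : fieldType.

Local Notation W := 'rV[F]_3.
Local Notation S := {malg F[smon]}.
Local Notation SS := {malg F[smon2]}.
Definition L := {linear S -> W}.

(* The monomial w_I, with w_I = 0 unless I indexes a basis monomial; this makes
   0 both w_1 ^ 2 and the degree 0 terms dropped in the reduced coproduct. *)
Definition mon (I : midx) : S :=
  if insub I is Some J then << (J : smon) >> else 0.

Definition tens (x y : S) : SS :=
  linext (fun i => linext (fun j => << (i, j) >> : SS) y) x.

(* The tensor product f (x) g with the Koszul sign rule, q being the parity of
   g: (f (x) g)(a (x) b) = (-1)^(q |a|) f(a) (x) g(b). *)
Definition tensmap (q : bool) (f g : S -> S) : SS -> SS :=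
  linext (fun ij : smon2 =>
    (-1) ^+ (q && par_mon ij.1) *: tens (f << ij.1 >>) (g << ij.2 >>)).
HB.instance Definition _ q f g := GRing.Linear.on (tensmap q f g).

(* The reduced coproduct: the sum over unshuffles of w_J.  With a single odd
   generator no two odd factors are ever exchanged, so no sign occurs. *)
Definition coproduct : S -> SS :=
  linext (fun J : smon => \sum_(K <- mbelow (val J))
    (mbin (val J) K)%:R *: tens (mon K) (mon (msub (val J) K))).
HB.instance Definition _ := GRing.Linear.on coproduct.

Definition coderivation (q : bool) (D : S -> S) : Prop :=
  forall x, coproduct (D x) =
    tensmap false D id (coproduct x) + tensmap q id D (coproduct x).

Definition comorphism (g : S -> S) : Prop :=
  forall x, coproduct (g x) = tensmap false g g (coproduct x).

Definition homogS (p : bool) (x : S) : Prop :=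
  forall J, J \in msupp x -> par_mon J = p.
Definition homogW (p : bool) (v : W) : Prop :=
  forall j, v 0 j != 0 -> par_gen j = p.

Definition evenmap (g : S -> S) : Prop :=
  forall p x, homogS p x -> homogS p (g x).
Definition oddmap (d : L) : Prop :=
  forall p x, homogS p x -> homogW (~~ p) (d x).

(* The coderivation of S(W) with corestriction d:
   w_J |-> sum over unshuffles w_J -> w_K (x) w_(J-K) of d(w_K) w_(J-K),
   where K = J is allowed and w_j w_M = w_(M + munit j).  That this is a
   coderivation with corestriction d is coder_coderivation and coder_corestr. *)
Definition coder (d : L) : S -> S :=
  linext (fun J : smon => \sum_(K <- mbelow (val J)) (mbin (val J) K)%:R *:
    \sum_(j < 3) d (mon K) 0 j *: mon (madd (msub (val J) K) (munit j))).
HB.instance Definition _ d := GRing.Linear.on (coder d).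

Definition corestr : S -> W :=
  linext (fun J : smon => \row_(j < 3) (val J == munit j)%:R : W).
HB.instance Definition _ := GRing.Linear.on corestr.

(* The graded commutator of endomorphisms of parities p and q. *)
Definition gcomm (p q : bool) (D E : S -> S) (x : S) : S :=
  D (E x) - (-1) ^+ (p && q) *: E (D x).

Definition codifferential (d : L) : Prop :=
  oddmap d /\ forall x, gcomm true true (coder d) (coder d) x = 0.

Definition component (n : nat) (d : L) : L :=
  [the L of linext (fun J : smon => if mdeg (val J) == n then d << J >> else 0)].

(* d is an extension of dN, of degree N. *)
Definition leading_term (N : nat) (dN d : L) : Prop :=
  [/\ forall n, (n < N)%N -> component n d =1 (fun=> 0),
      component N d =1 dN & ~ dN =1 (fun=> 0)].

(* d' = g^-1 d g, for the coderivations of S(W), g being an automorphism with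
   inverse h. *)
Definition equivalent (d d' : L) : Prop :=
  exists (g : {linear S -> S}) (h : S -> S),
    [/\ comorphism g, evenmap g, cancel g h, cancel h g &
        coder d' =1 h \o coder d \o g].

(* The cochain written psi^I_(j+1) when it is odd, i.e. when I.1.1 = 0 <-> j = 0. *)
Definition phi (I : midx) (j : 'I_3) : L :=
  [the L of linext (fun J : smon =>
    if val J == I then (mfact I)%:R *: delta_mx 0 j else 0 : W)].

(* d is of the form d0 + d_(k+1) + d_(k+2) + ... with d_l in L_l. *)
Definition extends_above (k : nat) (d0 d : L) : Prop :=
  forall n, (n <= k)%N -> component n [the L of d \- d0] =1 (fun=> 0).

Definition d_base : L := phi (0, 2, 0)%N 0.
Definition d_ext (k : nat) : L := [the L of phi (0, 2, 0)%N 0 \+ phi (0, 0, k)%N 0].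

End SymmetricCoalgebra.

Section BinomialSums.
Variables (F : fieldType) (V : lmodType F).

Definition bsum (n : nat) (G : nat -> nat -> V) : V :=
  \sum_(k <- iota 0 n.+1) ('C(n, k))%:R *: G k (n - k)%N.

Lemma eq_bsum n G G' : (forall k, (k <= n)%N -> G k (n - k)%N = G' k (n - k)%N) ->
  bsum n G = bsum n G'.
Proof.
move=> e; rewrite /bsum big_seq [RHS]big_seq; apply: eq_bigr => k.
by rewrite mem_iota add0n ltnS /= => /e ->.
Qed.

Lemma bsumD n G G' : bsum n (fun k l => G k l + G' k l) = bsum n G + bsum n G'.
Proof. by rewrite /bsum -big_split /=; apply: eq_bigr => k _; rewrite scalerDr. Qed.

Lemma bsum0 G : bsum 0 G = G 0%N 0%N.
Proof. by rewrite /bsum big_seq1 bin0 scale1r. Qed.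

Lemma bsumS n G : bsum n.+1 G = bsum n (fun k l => G k.+1 l + G k l.+1).
Proof.
rewrite /bsum.
have E (m : nat) (H : nat -> V) : \sum_(k <- iota 0 m) H k = \sum_(k < m) H k.
  by rewrite -(big_mkord xpredT) /index_iota subn0.
rewrite !E big_ord_recl /= bin0 scale1r subn0.
under eq_bigr => i _ do rewrite /bump /= add1n binS natrD scalerDl subSS.
rewrite big_split /= big_ord_recr /= bin_small // scale0r addr0 addrA addrC.
under [in RHS]eq_bigr => i _ do rewrite scalerDr.
rewrite big_split /=; congr (_ + _).
rewrite [RHS]big_ord_recl /= bin0 scale1r subn0; congr (_ + _).
apply: eq_bigr => i _; rewrite /bump /= add1n.
by rewrite subnSK.
Qed.

Lemma bsum_sym n G : bsum n G = bsum n (fun k l => G l k).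
Proof.
elim: n G => [|n IH] G; first by rewrite !bsum0.
by rewrite !bsumS IH; apply: eq_bsum => k _; rewrite addrC.
Qed.

Lemma bsum_assoc n (H : nat -> nat -> nat -> V) :
  bsum n (fun q m => bsum q (fun k p => H k p m)) =
  bsum n (fun k t => bsum t (fun p m => H k p m)).
Proof.
elim: n H => [|n IH] H; first by rewrite !bsum0.
rewrite !bsumS.
transitivity (bsum n (fun q m => bsum q (fun k p =>
   (H k.+1 p m + H k p.+1 m) + H k p m.+1))).
  by apply: eq_bsum => k _; rewrite bsumS -bsumD.
rewrite IH; apply: eq_bsum => k _; rewrite bsumS -bsumD.
by apply: eq_bsum => l _; rewrite addrA.
Qed.

Lemma bsumZ n c G : bsum n (fun k l => c *: G k l) = c *: bsum n G.
Proof.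
rewrite /bsum scaler_sumr; apply: eq_bigr => k _.
by rewrite !scalerA mulrC.
Qed.

Lemma bsum_exch n m (H : nat -> nat -> nat -> nat -> V) :
  bsum n (fun k l => bsum m (fun k' l' => H k l k' l')) =
  bsum m (fun k' l' => bsum n (fun k l => H k l k' l')).
Proof.
rewrite /bsum; under eq_bigr do rewrite scaler_sumr.
rewrite exchange_big; apply: eq_bigr => k _; rewrite scaler_sumr.
by apply: eq_bigr => l _; rewrite !scalerA mulrC.
Qed.

Definition msum (J : midx) (G : midx -> midx -> V) : V :=
  \sum_(K <- mbelow J) (mbin J K)%:R *: G K (msub J K).

Lemma msumE J G : msum J G =
  bsum J.1.1 (fun a a' => bsum J.1.2 (fun b b' => bsum J.2 (fun c c' =>
    G (a, b, c) (a', b', c')))).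
Proof.
rewrite /msum /mbelow !big_allpairs_dep /bsum.
apply: eq_bigr => a _; rewrite scaler_sumr; apply: eq_bigr => b _.
rewrite !scaler_sumr; apply: eq_bigr => c _.
by rewrite !scalerA -!natrM.
Qed.

Lemma mem_mbelow J K : (K \in mbelow J) =
  [&& K.1.1 <= J.1.1, K.1.2 <= J.1.2 & K.2 <= J.2]%N.
Proof.
case: K => [[a b] c]; rewrite /mbelow; apply/allpairsPdep/idP => [|].
    case=> [[a' b'] [c' []]] /allpairsPdep [? [? []]].
  rewrite !mem_iota !add0n !ltnS /= => ha hb [-> ->] hc [-> -> ->].
  by rewrite ha hb hc.
case/and3P => ha hb hc; exists (a, b), c; split; last by [].
  by apply/allpairsPdep; exists a, b; rewrite !mem_iota !add0n !ltnS ha hb.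
by rewrite mem_iota add0n ltnS hc.
Qed.

Lemma eq_msum J G G' : (forall K, K \in mbelow J ->
  G K (msub J K) = G' K (msub J K)) -> msum J G = msum J G'.
Proof.
move=> e; rewrite /msum big_seq [RHS]big_seq; apply: eq_bigr => K /e ->.
by [].
Qed.

Lemma msum_sym J G : msum J G = msum J (fun K M => G M K).
Proof.
rewrite !msumE bsum_sym; apply: eq_bsum => a _.
rewrite bsum_sym; apply: eq_bsum => b _.
by rewrite bsum_sym.
Qed.

Lemma msum_assoc J (H : midx -> midx -> midx -> V) :
  msum J (fun Q M => msum Q (fun K P => H K P M)) =
  msum J (fun K T => msum T (fun P M => H K P M)).
Proof.
rewrite !msumE.
transitivity (bsum J.1.1 (fun a a' => bsum a (fun d d' =>
  bsum J.1.2 (fun b b' => bsum b (fun e e' =>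
  bsum J.2 (fun c c' => bsum c (fun f f' => H (d, e, f) (d', e', f') (a', b', c')))))))).
  apply: eq_bsum => a _; rewrite bsum_exch.
  transitivity (bsum J.1.2 (fun b b' => bsum a (fun d d' => bsum J.2 (fun c c' =>
     bsum b (fun e e' => bsum c (fun f f' => H (d, e, f) (d', e', f') ((J.1.1 - a)%N, b', c'))))))).
    rewrite bsum_exch; apply: eq_bsum => b _; rewrite bsum_exch.
    by apply: eq_bsum => c _; rewrite msumE.
  rewrite -bsum_exch; apply: eq_bsum => d _; apply: eq_bsum => b _.
  by rewrite bsum_exch.
rewrite bsum_assoc.
transitivity (bsum J.1.1 (fun k t => bsum t (fun p m =>
  bsum J.1.2 (fun b b' => bsum b' (fun e e' =>
  bsum J.2 (fun c c' => bsum c' (fun f f' => H (k, b, c) (p, e, f) (m, e', f')))))))).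
  apply: eq_bsum => k _; apply: eq_bsum => p _.
  by rewrite bsum_assoc; do 2!(apply: eq_bsum => ? _); rewrite bsum_assoc.
apply: eq_bsum => k _; rewrite bsum_exch; apply: eq_bsum => b _.
transitivity (bsum (J.1.1 - k) (fun p m => bsum J.2 (fun c c' => bsum (J.1.2 - b) (fun e e' =>
   bsum c' (fun f f' => H (k, b, c) (p, e, f) (m, e', f')))))).
  by apply: eq_bsum => p _; rewrite bsum_exch.
rewrite bsum_exch; apply: eq_bsum => c _; rewrite msumE /=.
by [].
Qed.

Lemma msumD J G G' : msum J (fun K M => G K M + G' K M) = msum J G + msum J G'.
Proof. by rewrite /msum -big_split /=; apply: eq_bigr => K _; rewrite scalerDr. Qed.
Lemma msumZ J c G : msum J (fun K M => c *: G K M) = c *: msum J G.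
Proof.
rewrite /msum scaler_sumr; apply: eq_bigr => k _.
by rewrite !scalerA mulrC.
Qed.
Lemma msum_sum J (I : finType) (G : I -> midx -> midx -> V) :
  msum J (fun K M => \sum_i G i K M) = \sum_i msum J (G i).
Proof.
rewrite /msum exchange_big; apply: eq_bigr => K _; rewrite scaler_sumr.
by [].
Qed.
End BinomialSums.

Section Coder.
Variable F : fieldType.
Local Notation W := 'rV[F]_3.
Local Notation S := {malg F[smon]}.
Local Notation SS := {malg F[smon2]}.

Lemma msum_lin (V V' : lmodType F) (f : {linear V -> V'}) J G :
  f (msum J G) = msum J (fun K M => f (G K M)).
Proof. by rewrite /msum linear_sum; apply: eq_bigr => K _; rewrite linearZ. Qed.

Lemma lin_ext (V : lmodType F) (f g : {linear S -> V}) :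
  (forall J, f << J >> = g << J >>) -> f =1 g.
Proof.
move=> e x; rewrite [x]monalgE !linear_sum; apply: eq_bigr => J _.
have -> : << x@_J *g J >> = x@_J *: << J >> :> {malg F[smon]}.
  by apply/malgP => k; rewrite mcoeffU mcoeffZ mcoeffU mulr_natr.
by rewrite linearZ [in RHS]linearZ e.
Qed.

Definition tensl (y : S) : {linear S -> SS} := linext (fun i => linext (fun j => << (i, j) >> : SS) y).
Lemma tensE x y : tens x y = tensl y x. Proof. by []. Qed.
Lemma tensr_lin (x : S) : linear (@tens F x).
Proof.
move=> c y y'; rewrite /tens /linext scaler_sumr -big_split.
apply: eq_bigr => i _ /=.
rewrite !scalerA mulrC -scalerA -scalerDr; congr (_ *: _).
exact: (linearP (linext _)).
Qed.
HB.instance Definition _ x := GRing.isLinear.Build F S SS _ (@tens F x)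
  (tensr_lin x).

Lemma tensU i j : tens << i >> << j >> = << (i, j) >> :> SS.
Proof. by rewrite /tens !linextU. Qed.
Lemma tens0l y : tens 0 y = 0 :> SS. Proof. by rewrite tensE linear0. Qed.

Lemma monP I : (exists2 J : smon, val J = I & mon F I = << J >>) \/ 
   [/\ mon F I = 0 & ~~ ((I.1.1 <= 1) && (0 < mdeg I))%N].
Proof.
rewrite /mon; case: insubP => [J hI e|hI]; first by left; exists J.
by right.
Qed.
Lemma mon0 : mon F (0, 0, 0)%N = 0. Proof. by rewrite /mon insubF. Qed.
Lemma mon_val (J : smon) : mon F (val J) = << J >>.
Proof. by rewrite /mon valK. Qed.

Lemma tensmap_mon q (f g : {linear S -> S}) K M :
  tensmap q f g (tens (mon F K) (mon F M)) =
  (-1) ^+ (q && odd K.1.1) *: tens (f (mon F K)) (g (mon F M)).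
Proof.
have [[k <- ->]|[-> _]] := monP K; last by rewrite tens0l !linear0 tens0l scaler0.
have [[m <- ->]|[-> _]] := monP M; last by rewrite !linear0.
by rewrite tensU; apply: linextU.
Qed.

Lemma copr_mon J : (J.1.1 <= 1)%N -> coproduct (mon F J) =
  msum J (fun K M => tens (mon F K) (mon F M)).
Proof.
have [[j <- ->] _|[-> /nandP [/negP//|]]] := monP J; first by apply: linextU.
case: J => [[[|a] [|b]] [|c]] //= _ _.
by rewrite linear0 msumE !bsum0 mon0 tens0l.
Qed.

Lemma coder_mon (d : L F) J : (J.1.1 <= 1)%N -> coder d (mon F J) =
  msum J (fun K M => \sum_(j < 3) d (mon F K) 0 j *: mon F (madd M (munit j))).
Proof.
have [[j <- ->] _|[-> /nandP [/negP//|]]] := monP J; first by apply: linextU.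
case: J => [[[|a] [|b]] [|c]] //= _ _.
rewrite linear0 msumE !bsum0 big1 // => j _.
by rewrite mon0 linear0 mxE scale0r.
Qed.

Lemma odd_coef (d : L F) K j : oddmap d -> d (mon F K) 0 j != 0 ->
  (K.1.1 <= 1)%N /\ (j == 0 :> nat) = (K.1.1 != 1%N).
Proof.
move=> od; have [[k <- ->]|[-> _]] := monP K; last by rewrite linear0 mxE eqxx.
have h : homogS (par_mon k) (<< k >> : S).
  by move=> J; rewrite msuppU oner_eq0 inE => /eqP ->.
move=> /(od _ _ h); rewrite /par_gen /par_mon => ->.
by case/andP: (valP k); case: (_.1.1) => [|[]].
Qed.

Lemma mon2 a b c : mon F (a.+2, b, c) = 0.
Proof. by rewrite /mon insubF. Qed.

Lemma copr_madd M (j : 'I_3) : (M.1.1 <= 1)%N -> 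
  coproduct (mon F (madd M (munit j))) =
  msum M (fun P N => tens (mon F (madd P (munit j))) (mon F N) +
    (-1) ^+ ((j == 0 :> nat) && odd P.1.1) *: tens (mon F P) (mon F (madd N (munit j)))).
Proof.
case: M => [[a b] c] /= ha.
case: j => [[|[|[|//]]] ij] /=; rewrite /madd /munit /=.
- rewrite !addn0 addn1; case: a ha => [|[]] //= _.
    rewrite copr_mon; last by [].
    rewrite !msumE bsumS bsum0 bsum0 /= -bsumD; apply: eq_bsum => b' _.
    rewrite -bsumD; apply: eq_bsum => c' _ /=.
    by rewrite !addn0 !addn1 scale1r.
  rewrite mon2 linear0 !msumE bsumS !bsum0 -bsumD /=.
  apply/esym; transitivity (bsum b (fun _ _ => 0 : SS)).
    apply: eq_bsum => b' _; rewrite -bsumD.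
    transitivity (bsum c (fun _ _ => 0 : SS)); last first.
      by rewrite /bsum big1 // => k _; rewrite scaler0.
    apply: eq_bsum => c' _ /=; rewrite !addn0 !addn1 !mon2 !tens0l.
    by rewrite !linear0 add0r ?scaler0 addr0 scaleN1r addNr.
  by rewrite /bsum big1 // => k _; rewrite scaler0.
- rewrite !addn0 !addn1 copr_mon; last by [].
  rewrite !msumE; apply: eq_bsum => a' _.
  rewrite bsumS; apply: eq_bsum => b' _; rewrite -bsumD; apply: eq_bsum => c' _ /=.
  by rewrite !addn0 !addn1 scale1r.
- rewrite !addn0 !addn1 copr_mon; last by [].
  rewrite !msumE; apply: eq_bsum => a' _.
  apply: eq_bsum => b' _; rewrite bsumS; apply: eq_bsum => c' _ /=.
  by rewrite !addn0 !addn1 scale1r.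
Qed.

Lemma coder_coderivation (d : L F) : oddmap d -> coderivation true (coder d).
Proof.
move=> od.
pose id' : {linear S -> S} := idfun.
suff H J : coproduct (coder d << J >>) =
    tensmap false (coder d) id' (coproduct << J >>) +
    tensmap true id' (coder d) (coproduct << J >>).
  pose f : {linear S -> SS} := @coproduct F \o coder d.
  pose g : {linear S -> SS} := (tensmap false (coder d) id' \o @coproduct F)
   \+ (tensmap true id' (coder d) \o @coproduct F).
  exact: (@lin_ext _ f g).
rewrite -mon_val; case: J => J /= /andP [hJ _].
rewrite (copr_mon hJ) (coder_mon d hJ) !msum_lin.
pose a j K : F := d (mon F K) 0 j.
transitivity (msum J (fun K M => msum M (fun P N => \sum_(j < 3) a j K *:
    tens (mon F (madd P (munit j))) (mon F N))) +
  msum J (fun K M => msum M (fun P N => (-1) ^+ (odd P.1.1) *: \sum_(j < 3) a j K *: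
    tens (mon F P) (mon F (madd N (munit j)))))).
  rewrite -msumD; apply: eq_msum => K; rewrite mem_mbelow => /and3P [hK _ _].
  rewrite -msumD linear_sum /=.
  under eq_bigr => j _ do rewrite linearZ /= copr_madd ?(leq_trans (leq_subr _ _)) // -msumZ.
  rewrite -msum_sum; apply: eq_msum => P; rewrite mem_mbelow => /and3P [hP _ _].
  rewrite scaler_sumr -big_split; apply: eq_bigr => j _ /=.
  rewrite scalerDr !scalerA.
  suff -> : d (mon F K) 0 j * (-1) ^+ ((j == 0 :> nat) && odd P.1.1) =
            (-1) ^+ odd P.1.1 * a j K by [].
  have [/eqP a0|nz] := boolP (a j K == 0); first by rewrite -/(a j K) a0 mul0r mulr0.
  rewrite mulrC; congr (_ * _).
  have [hK1 ->] := odd_coef od nz.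
  by move: hP hK hJ hK1; rewrite /=; case: (K.1.1) => [|[|]] //;
    case: (J.1.1) => [|[|]] //; case: (P.1.1) => [|[|]].
apply: f_equal2.
  rewrite -(msum_assoc J (fun K P M => \sum_(j < 3) a j K *: tens (mon F (madd P (munit j))) (mon F M))).
  apply: eq_msum => Q; rewrite mem_mbelow => /and3P [hQ _ _].
  rewrite /= (tensmap_mon false (coder d) id') scale1r /= (coder_mon d (leq_trans hQ hJ)).
  rewrite tensE msum_lin; apply: eq_msum => K _.
  by rewrite linear_sum; apply: eq_bigr => j _; rewrite linearZ.
pose H Q N K := (-1) ^+ odd Q.1.1 *: \sum_(j < 3) a j K *:
  tens (mon F Q) (mon F (madd N (munit j))).
transitivity (msum J (fun Q T => msum T (fun N K => H Q N K))).
  apply: (etrans _ (msum_assoc J H)).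
  exact: (msum_sym J (fun K M => msum M (fun P N => H P N K))).
apply: eq_msum => Q; rewrite mem_mbelow => /and3P [hQ _ _].
rewrite /= (tensmap_mon true id' (coder d)) /= coder_mon ?(leq_trans (leq_subr _ _)) //.
rewrite msum_lin msumZ; congr (_ *: _); rewrite msum_sym; apply: eq_msum => K _.
by rewrite linear_sum; apply: eq_bigr => j _; rewrite linearZ.
Qed.

Lemma corestr_mon I (j : 'I_3) : (0 < mdeg I)%N -> corestr (mon F I) 0 j = (I == munit j)%:R.
Proof.
have [[J <- ->] _|[-> h] hI] := monP I; first by rewrite /corestr linextU mxE.
rewrite linear0 mxE; case: eqP => // e; move: h; rewrite e.
by case: j {e} => [[|[|[]]]].
Qed.

Lemma madd_gt0 M (j : 'I_3) : (0 < mdeg (madd M (munit j)))%N.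
Proof.
rewrite /mdeg /madd /munit /=.
by case: j => [[|[|[|//]]] ij] /=; rewrite ?addn0 ?addn1 ?addnS ?addSn.
Qed.
Lemma madd_munit M (i j : 'I_3) :
  (madd M (munit j) == munit i) = (M == (0, 0, 0)%N) && (j == i).
Proof.
case: M => [[a b] c]; rewrite /madd /munit /= -!val_eqE /= !xpair_eqE.
case: i j => [[|[|[|//]]] ii] [[|[|[|//]]] ij] /=; rewrite ?addn0 ?addn1;
  by case: a b c => [|[]] // [|[]] // [|[]].
Qed.
Lemma coder_corestr (d : L F) x : corestr (coder d x) = d x.
Proof.
pose f : {linear S -> W} := @corestr F \o coder d.
apply: (@lin_ext _ f d) => J /=; rewrite -mon_val.
case: J => J /= /andP [hJ hd].
apply/rowP => i; rewrite (coder_mon d hJ) msum_lin.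
have E K M : corestr (\sum_(j < 3) d (mon F K) 0 j *: mon F (madd M (munit j))) =
   if M == (0, 0, 0)%N then d (mon F K) else 0.
  rewrite linear_sum /=; apply/rowP => i'; rewrite summxE.
  under eq_bigr => j _ do rewrite linearZ mxE corestr_mon ?madd_gt0 // madd_munit.
  case: eqP => _ /=; last by rewrite big1 ?mxE // => j _; rewrite mulr0.
  rewrite (bigD1 i') //= eqxx mulr1 big1 ?addr0 // => j /negPf ->.
  by rewrite mulr0.
transitivity (msum J (fun K M => if M == (0, 0, 0)%N then d (mon F K) else 0) 0 i).
  by apply: (congr1 (fun v : W => v 0 i)); apply: eq_msum => K _; apply: E.
suff -> : msum J (fun K M => if M == (0, 0, 0)%N then d (mon F K) else 0) =
          d (mon F J) by [].
have Z (G : nat -> nat -> W) n : (forall k l, G k l.+1 = 0) -> bsum n G = G n 0%N.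
  move=> G0; elim: n G G0 => [|n IH] G G0; first by rewrite bsum0.
  by rewrite bsumS IH ?G0 ?addr0 // => k l; rewrite !G0 addr0.
have Z0 n : bsum n (fun _ _ => 0 : W) = 0 by rewrite Z.
rewrite msumE Z => [|k l]; last first.
  by rewrite -[RHS](Z0 J.1.2); apply: eq_bsum => b _; apply: Z0.
rewrite Z => [|k l]; last by apply: Z0.
by rewrite Z //; case: J {hJ hd} => [[]].
Qed.
End Coder.

(* Main.v *)
From HB Require Import structures.
From mathcomp Require Import all_boot all_order all_algebra.
From mathcomp Require Import reals complex finmap monalg boolp ring zify.
Require Import Defs.

(** Dually, coderivations of S(W) are formal vector fields in an odd variable
    theta and even variables y, z, and coalgebra automorphisms are formal
    changes of variables.  An odd vector field is a d/dtheta + theta X with a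
    in C[[y, z]] and X even; its square vanishes only if a X = 0, and a <> 0
    since a = y^2 + ..., so X = 0.  Substituting theta u, Y, Z for theta, y, z
    carries a d/dtheta to a' d/dtheta when a u = a'(Y, Z), which leaves the
    contact classification of the series a = y^2 + ....  By Weierstrass
    preparation and completion of the square, a U = (y + h(z))^2 + r(z) with U
    a unit.  If r = 0 this is the base codifferential; otherwise r = z^m v with
    v a unit, and multiplication by 1/v = b^2 gives
    a U b^2 = (b (y + h))^2 + z^m.  When a = y^2 + z^k + terms of degree > k,
    the order m of r is k. *)

Set Implicit Arguments.
Unset Strict Implicit.
Unset Printing Implicit Defensive.

Import Order.TTheory GRing.Theory Num.Theory.
Local Open Scope ring_scope.

(** * Arithmetic of multi-indices and of the binomial convolution *)

Local Notation mzero := (0, 0, 0)%N.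

Lemma mbelow_uniq J : uniq (mbelow J).
Proof.
by apply: allpairs_uniq; [apply: allpairs_uniq| |];
  rewrite ?iota_uniq // => -[? ?] [? ?] _ _ [-> ->].
Qed.

Lemma maddC A B : madd A B = madd B A.
Proof. by congr (_, _, _); apply: addnC. Qed.

Lemma madd0 A : madd A (0, 0, 0)%N = A.
Proof. by case: A => [[a b] c]; rewrite /madd /= !addn0. Qed.

Lemma maddKl A B : msub (madd A B) A = B.
Proof. by case: A B => [[a b] c] [[a' b'] c']; rewrite /msub /= !addKn. Qed.

Lemma madd_inj A : injective (madd A).
Proof. by move=> B C e; rewrite -(maddKl A B) e maddKl. Qed.

Lemma mdegD A B : mdeg (madd A B) = (mdeg A + mdeg B)%N.
Proof. rewrite /mdeg /=; lia. Qed.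

Lemma mdeg_eq0 A : (mdeg A == 0)%N = (A == (0, 0, 0)%N).
Proof. by case: A => [[a b] c]; rewrite /mdeg /= !xpair_eqE !addn_eq0. Qed.

Lemma msubK J K : K \in mbelow J -> madd K (msub J K) = J.
Proof.
rewrite mem_mbelow; case: J K => [[a b] c] [[a' b'] c'] /= /and3P [? ? ?].
by rewrite /madd /= !subnKC.
Qed.

Lemma mbelow_madd A B : A \in mbelow (madd A B).
Proof. by rewrite mem_mbelow !leq_addr. Qed.

Lemma mbelowP A J : reflect (exists B, J = madd A B) (A \in mbelow J).
Proof.
apply: (iffP idP) => [/msubK <-|[B ->]]; [by eexists|exact: mbelow_madd].
Qed.

Lemma mfactD A B : (mbin (madd A B) A * (mfact A * mfact B))%N = mfact (madd A B).
Proof.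
have bf m n : ('C(m + n, m) * (m`! * n`!))%N = (m + n)`!.
  by rewrite -[X in (_ * X`!)%N](addKn m) bin_fact ?leq_addr.
rewrite /mbin /mfact /= -!bf; ring.
Qed.

Lemma mfact_gt0 A : (0 < mfact A)%N.
Proof. by rewrite /mfact !muln_gt0 !fact_gt0. Qed.

Lemma mbin_gt0 A B : (0 < mbin (madd A B) A)%N.
Proof. by rewrite /mbin !muln_gt0 !bin_gt0 !leq_addr. Qed.

Lemma msum_single (F : fieldType) (V : lmodType F) (J A : midx)
    (G : midx -> midx -> V) :
  (forall K M, J = madd K M -> K != A -> G K M = 0) ->
  msum J G = if A \in mbelow J then (mbin J A)%:R *: G A (msub J A) else 0.
Proof.
move=> G0; rewrite /msum; case: ifP => hA.
  rewrite (bigD1_seq A) ?mbelow_uniq //= big_seq_cond big1 ?addr0 // => K.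
  by case/andP => /msubK e nKA; rewrite G0 ?scaler0 ?e.
rewrite big_seq big1 // => K hK; rewrite G0 ?scaler0 ?msubK //.
by apply: contraFneq hA => <-.
Qed.

Lemma msum0 (F : fieldType) (V : lmodType F) J (G : midx -> midx -> V) :
  (forall K M, J = madd K M -> G K M = 0) -> msum J G = 0.
Proof.
move=> G0; rewrite /msum big_seq big1 // => K /msubK e.
by rewrite G0 ?scaler0.
Qed.

(** * The commutative ring of formal power series *)

(* Series in theta, y, z given by exponential coefficients, which makes the
   binomial convolution msum their product. *)
Definition ser (F : fieldType) : Type := midx -> F.
HB.instance Definition _ F := gen_eqMixin (ser F).
HB.instance Definition _ F := gen_choiceMixin (ser F).

Section Series.
Variable F : fieldType.
Implicit Types f g : ser F.

Definition ser_zero : ser F := fun=> 0.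
Definition ser_opp f : ser F := fun J => - f J.
Definition ser_add f g : ser F := fun J => f J + g J.
Definition ser_one : ser F := fun J => (J == (0, 0, 0)%N)%:R.
Definition ser_mul f g : ser F := fun J => msum J (fun K M => f K * g M : F^o).

Fact ser_addA : associative ser_add.
Proof. by move=> f g h; apply/funext => J; apply: addrA. Qed.
Fact ser_addC : commutative ser_add.
Proof. by move=> f g; apply/funext => J; apply: addrC. Qed.
Fact ser_add0 : left_id ser_zero ser_add.
Proof. by move=> f; apply/funext => J; apply: add0r. Qed.
Fact ser_addN : left_inverse ser_zero ser_opp ser_add.
Proof. by move=> f; apply/funext => J; apply: addNr. Qed.

HB.instance Definition _ := GRing.isZmodule.Build (ser F)
  ser_addA ser_addC ser_add0 ser_addN.

Fact ser_mulC : commutative ser_mul.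
Proof.
move=> f g; apply/funext => J; rewrite /ser_mul msum_sym.
by apply: (@eq_msum F F^o) => K _; apply: mulrC.
Qed.

Fact ser_mulA : associative ser_mul.
Proof.
move=> f g h; apply/funext => J; rewrite /ser_mul; apply/esym.
transitivity (msum J (fun Q M => msum Q (fun K P => f K * (g P * h M) : F^o))).
  apply: (@eq_msum F F^o) => K _; rewrite mulrC -[LHS](@msumZ F F^o).
  by apply: (@eq_msum F F^o) => P _; rewrite mulrA [RHS]mulrC.
by rewrite msum_assoc; apply: (@eq_msum F F^o) => K _; rewrite -[RHS](@msumZ F F^o).
Qed.

Fact ser_mul1 : left_id ser_one ser_mul.
Proof.
move=> f; apply/funext => J; rewrite /ser_mul (@msum_single _ _ _ (0, 0, 0)%N).
  by rewrite mem_mbelow /= /mbin !bin0 scale1r mul1r /msub !subn0; case: J => [[]].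
by move=> K M _ /negPf n0; rewrite /ser_one n0 mul0r.
Qed.

Fact ser_mulD : left_distributive ser_mul ser_add.
Proof.
move=> f g h; apply/funext => J; rewrite /ser_mul /ser_add -[RHS](@msumD F F^o).
by apply: (@eq_msum F F^o) => K _; rewrite mulrDl.
Qed.

Fact ser_neq0 : ser_one != 0.
Proof.
apply/eqP => /(congr1 (fun f : ser F => f (0, 0, 0)%N)) /eqP.
by rewrite /ser_one /= oner_eq0.
Qed.

HB.instance Definition _ := GRing.Zmodule_isComNzRing.Build (ser F)
  ser_mulA ser_mulC ser_mul1 ser_mulD ser_neq0.

Lemma serD f g J : (f + g) J = f J + g J. Proof. by []. Qed.
Lemma serN f J : (- f) J = - f J. Proof. by []. Qed.
Lemma ser0 J : (0 : ser F) J = 0. Proof. by []. Qed.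
Lemma ser1 J : (1 : ser F) J = (J == (0, 0, 0)%N)%:R. Proof. by []. Qed.
Lemma serM f g J : (f * g) J = msum J (fun K M => f K * g M : F^o).
Proof. by []. Qed.

End Series.

(** * Orders, leading monomials and recursion on the total degree *)

Section SeriesTheory.
Variable F : fieldType.
Implicit Types (f g : ser F) (A B J K M : midx).

Definition vanish n f := forall J, (mdeg J < n)%N -> f J = 0.
(** Stronger than a choice of leading term: [A] must be the only index of its degree, or of a lower
    one, at which [f] may be nonzero. Products then have a computable leading coefficient. *)
Definition lead f A c := forall J, (mdeg J <= mdeg A)%N -> f J = if J == A then c else 0.
(** Homogeneity in theta. In [ser F] the power theta^2 is not zero; exponents of theta above 1 are
    ignored only by the pairing with S(W). *)
Definition hom n f := forall J, J.1.1 != n -> f J = 0.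
(** The monomial itself; the factorial is its exponential coefficient. *)
Definition X A : ser F := fun J => if J == A then (mfact A)%:R else 0.
Definition trunc n f : ser F := fun J => if (mdeg J < n)%N then f J else 0.

Lemma serM_single A f g J :
  (forall K M, J = madd K M -> K != A -> f K * g M = 0) ->
  (f * g) J = if A \in mbelow J then (mbin J A)%:R * (f A * g (msub J A)) else 0.
Proof. exact: (@msum_single F F^o). Qed.

Lemma serM_eq0 f g J :
  (forall K M, J = madd K M -> f K * g M = 0) -> (f * g) J = 0.
Proof. exact: (@msum0 F F^o). Qed.

(** In this range of degrees only the term of [f] at [A] contributes: other indices of degree at
    most that of [A] carry a zero coefficient, and an index of larger degree leaves a factor of [g]
    of degree below [n]. *)
Lemma serM_lead f g A c n J : lead f A c -> vanish n g ->
    (mdeg J <= mdeg A + n)%N ->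
  (f * g) J = if A \in mbelow J then (mbin J A)%:R * (c * g (msub J A)) else 0.
Proof.
move=> lf vg hJ; rewrite (serM_single (A := A)) => [|K M eJ nKA].
  by case: ifP => // _; rewrite lf // eqxx.
have [hK|hK] := leqP (mdeg K) (mdeg A); first by rewrite lf // (negPf nKA) mul0r.
by rewrite vg ?mulr0 //; move: hJ; rewrite eJ mdegD; lia.
Qed.

Lemma lead_vanish f A c : lead f A c -> vanish (mdeg A) f.
Proof.
move=> lf J hJ; rewrite lf ?(ltnW hJ) //; case: eqP => // e.
by rewrite e ltnn in hJ.
Qed.

Lemma leadM f g A B c c' : lead f A c -> lead g B c' ->
  lead (f * g) (madd A B) ((mbin (madd A B) A)%:R * (c * c')).
Proof.
move=> lf lg J; rewrite mdegD => hJ; rewrite (serM_lead lf (lead_vanish lg) hJ).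
case: (mbelowP A J) => [[B' e]|nA].
  rewrite e in hJ *; rewrite maddKl (inj_eq (@madd_inj A)).
  rewrite mdegD leq_add2l in hJ; rewrite lg //.
  by case: eqP => [-> //|_]; rewrite !mulr0.
by case: eqP => // e; case: nA; exists B.
Qed.

Lemma lead_unit f : lead f mzero (f mzero).
Proof.
by move=> J; rewrite leqn0 mdeg_eq0 => /eqP ->; rewrite eqxx.
Qed.

Lemma lead_X A : lead (X A) A (mfact A)%:R.
Proof. by []. Qed.

Lemma serM0 f g : (f * g) mzero = f mzero * g mzero.
Proof.
rewrite (@serM_lead _ _ _ _ 0 _ (lead_unit f)) //.
by rewrite mem_mbelow /= /mbin !bin0 mul1r.
Qed.

Lemma serXM A f J : (X A * f) J =
  if A \in mbelow J then (mbin J A)%:R * ((mfact A)%:R * f (msub J A)) else 0.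
Proof.
rewrite (serM_single (A := A)) => [|K M _ /negPf nKA]; last first.
  by rewrite /X nKA mul0r.
by rewrite /X eqxx.
Qed.

Lemma serX_madd A f M : (X A * f) (madd A M) =
  (mbin (madd A M) A)%:R * ((mfact A)%:R * f M).
Proof. by rewrite serXM mbelow_madd maddKl. Qed.

Lemma X_madd A B : X A * X B = X (madd A B).
Proof.
apply/funext => J; rewrite serXM; case: (mbelowP A J) => [[B' ->]|nA].
  rewrite maddKl /X (inj_eq (@madd_inj A)); case: eqP => [->|_].
    by rewrite -!natrM mfactD.
  by rewrite !mulr0.
by rewrite /X; case: eqP => // e; case: nA; exists B.
Qed.

Lemma X_expn m : X (0, 0, 1)%N ^+ m = X (0, 0, m)%N.
Proof.
elim: m => [|m IH]; last by rewrite exprS IH X_madd /madd /= add1n.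
by apply/funext => J; rewrite expr0 ser1 /X; case: eqP.
Qed.

Lemma homM m n f g : hom m f -> hom n g -> hom (m + n) (f * g).
Proof.
move=> hf hg J hJ; apply: serM_eq0 => K M eJ.
have [e|nK] := eqVneq K.1.1 m; last by rewrite hf ?mul0r.
rewrite hg ?mulr0 //; apply: contra hJ => /eqP e'.
by rewrite eJ /= e e'.
Qed.

Lemma homD n f g : hom n f -> hom n g -> hom n (f + g).
Proof. by move=> hf hg J hJ; rewrite serD hf ?hg ?addr0. Qed.

Lemma homN n f : hom n f -> hom n (- f).
Proof. by move=> hf J hJ; rewrite serN hf ?oppr0. Qed.

Lemma hom1 : hom 0 1.
Proof. by move=> J hJ; rewrite ser1; case: eqP => // e; rewrite e in hJ. Qed.

Lemma homX A : hom A.1.1 (X A).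
Proof. by move=> J hJ; rewrite /X; case: eqP => // e; rewrite e eqxx in hJ. Qed.

Lemma homXn m n f : hom m f -> hom (m * n)%N (f ^+ n).
Proof.
move=> hf; elim: n => [|n IH]; first by rewrite muln0; apply: hom1.
by rewrite exprS mulnS; apply: homM.
Qed.

Lemma trunc_eq n f g : (forall M, (mdeg M < n)%N -> f M = g M) ->
  trunc n f = trunc n g.
Proof.
by move=> e; apply/funext => J; rewrite /trunc; case: ifP => // /e.
Qed.

Lemma vanish_trunc n f : vanish n (f - trunc n f).
Proof. by move=> J hJ; rewrite serD serN /trunc hJ subrr. Qed.

Lemma trunc_out n f J : (n <= mdeg J)%N -> (f - trunc n f) J = f J.
Proof. by move=> hJ; rewrite serD serN /trunc ltnNge hJ oppr0 addr0. Qed.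

(** Solves an implicit equation for a series degree by degree: when each coefficient of [Phi f]
    depends on strictly lower degrees of [f], the iterates of [Phi] become stationary at [J] after
    [mdeg J + 1] steps. *)
Lemma deg_fixpoint (Phi : ser F -> ser F) :
  (forall J f g, (forall M, (mdeg M < mdeg J)%N -> f M = g M) ->
     Phi f J = Phi g J) ->
  exists f, f = Phi f.
Proof.
move=> hPhi; pose it n : ser F := iter n Phi 0.
have stab n m J : (mdeg J < n)%N -> (n <= m)%N -> it n J = it m J.
  elim: n m J => // n IH [//|m] J hJ hm.
  by rewrite /it !iterS; apply: hPhi => M hM; apply: IH; rewrite ?(leq_trans hM).
exists (fun J => it (mdeg J).+1 J); apply/funext => J.
by rewrite /it iterS; apply: hPhi => M hM; rewrite -/(it _) -(stab _ _ _ (ltnSn _) hM).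
Qed.

End SeriesTheory.

(** * Contact normal form of a series starting with y^2 *)

Section NormalForm.
Variable F : numClosedFieldType.
Implicit Types (f g a : ser F) (J K M : midx).

Local Notation y2 := (0, 2, 0)%N.

(* The degree 2 case of the Weierstrass preparation theorem; as a starts with
   y^2, the coefficients of U are determined by induction on the total degree. *)
Lemma weierstrass2 a : lead a y2 2 -> hom 0 a ->
  exists U : ser F, [/\ hom 0 U, U mzero = 1 &
    forall J, (a * U) (madd y2 J) = (J == mzero)%:R * 2].
Proof.
move=> la ha.
(* In [a * U] at [madd y2 J], the coefficient of [U] at [J] enters only through the leading term of
   [a], with the nonzero factor in the denominator; everything else comes from lower degrees of [U].
   [Phi] solves for the value making the sum vanish. *)
pose Phi f : ser F := fun J => if J.1.1 != 0%N then 0 else if J == mzero then 1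
  else - (a * trunc (mdeg J) f) (madd y2 J) / ((mbin (madd y2 J) y2)%:R * 2).
have [|U eU] := @deg_fixpoint _ Phi.
  by move=> J f g /trunc_eq e; rewrite /Phi e.
have hU : hom 0 U by move=> J hJ; rewrite eU /Phi hJ.
exists U; split=> // [|J]; first by rewrite eU.
have [hJ|hJ] := eqVneq J.1.1 0%N; last first.
  rewrite (homM ha hU) //; case: eqP => [e|]; last by rewrite mul0r.
  by rewrite e in hJ.
rewrite -[in LHS](subrK (trunc (mdeg J) U) U) mulrDr serD.
rewrite (serM_lead la (@vanish_trunc _ (mdeg J) U)) ?mdegD //.
rewrite mbelow_madd maddKl trunc_out //.
have nz : (mbin (madd y2 J) y2)%:R * 2 != 0 :> F.
  by rewrite mulf_neq0 ?pnatr_eq0 // -lt0n mbin_gt0.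
rewrite {1}eU /Phi hJ /= mulrA.
case: eqP => [->|_]; last by rewrite mulrC divfK // mul0r addNr.
have -> : trunc (mdeg mzero) U = 0 by apply/funext => M; rewrite /trunc /mdeg.
by rewrite mulr0 addr0 mulr1 /mbin /= !mul1r.
Qed.

(** The constant coefficient of [b] is a square root, available in a closed field; each later
    coefficient solves a linear equation whose slope is [2 * b0 * v mzero]. *)
Lemma inv_sqrt_exists v : hom 0 v -> v mzero != 0 ->
  exists b : ser F, [/\ hom 0 b, b mzero != 0 & b ^+ 2 * v = 1].
Proof.
move=> hv v0; pose b0 := sqrtC (v mzero)^-1.
have b02 : b0 ^+ 2 = (v mzero)^-1 by rewrite sqrtCK.
have b0n : b0 != 0 by rewrite sqrtC_eq0 invr_eq0.
pose Phi f : ser F := fun J => if J.1.1 != 0%N then 0 else if J == mzero then b0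
  else - (trunc (mdeg J) f ^+ 2 * v) J / (2 * b0 * v mzero).
have [|b eb] := @deg_fixpoint _ Phi.
  by move=> J f g /trunc_eq e; rewrite /Phi e.
have hb : hom 0 b by move=> J hJ; rewrite eb /Phi hJ.
have eb0 : b mzero = b0 by rewrite eb.
exists b; split; rewrite ?eb0 //; apply/funext => J; rewrite ser1.
have [hJ|hJ] := eqVneq J.1.1 0%N; last first.
  rewrite (homM (homXn (n := 2) hb) hv) //; case: eqP => [e|//].
  by rewrite e in hJ.
have [->|nJ] := eqVneq J mzero; first by rewrite serM0 expr2 serM0 eb0 -expr2 b02 mulVf.
have dJ : (0 < mdeg J)%N by rewrite lt0n mdeg_eq0.
set t := trunc (mdeg J) b; pose s := b - t.
have vs : vanish (mdeg J) s by apply: vanish_trunc.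
have t0 : t mzero = b0 by rewrite /t /trunc /= dJ.
have s0 : s mzero = 0 by apply: vs.
(* With [b = t + s] and [s] starting in the degree of [J], only the two cross terms see the
   coefficient of [b] at [J]; the term quadratic in [s] vanishes there. *)
have -> : b ^+ 2 * v = t ^+ 2 * v + (t * v) * s + (t * v) * s + (s * v) * s.
  by rewrite /s; ring.
have bJ : mzero \in mbelow J by rewrite mem_mbelow.
have E f : (f * s) J = f mzero * b J.
  rewrite (serM_lead (lead_unit f) vs) // bJ /mbin !bin0 mul1r.
  have -> : msub J mzero = J by case: (J) => [[? ?] ?]; rewrite /msub /= !subn0.
  by rewrite /s trunc_out.
rewrite !serD !E !serM0 t0 s0 !mul0r addr0.
rewrite eb /Phi hJ (negPf nJ) /= -/t; field.
by rewrite v0 b0n.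
Qed.

(** Weierstrass preparation gives [a U = y^2 + 2 h(z) y + q(z)], hence [r = q - h^2]. Since [h] has
    order at least [n - 1] and [n > 2], [h^2] has no term of degree at most [n], so [r] and [q]
    agree there. *)
Lemma complete_square a n : (2 < n)%N -> hom 0 a ->
    (forall J, (mdeg J < n)%N -> a J = X F y2 J) ->
  exists U h r : ser F,
    [/\ [/\ hom 0 U, hom 0 h & hom 0 r], U mzero != 0, vanish 2 h,
      a * U = (X F (0, 1, 0)%N + h) ^+ 2 + r &
      [/\ forall J, J.1.2 != 0%N -> r J = 0,
          forall c, (c < n)%N -> r (0, 0, c)%N = 0 &
          r (0, 0, n)%N = a (0, 0, n)%N]].
Proof.
move=> hn ha ea.
have la : lead a y2 2.
  by move=> J hJ; rewrite ea ?(leq_ltn_trans hJ).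
have [U [hU U0 eU]] := weierstrass2 la ha.
(* The exponential coefficients of [y z^c] and of [z^c] carry the same factorial, so halving is the
   only correction. *)
pose h : ser F := fun J =>
  if (J.1.1 == 0%N) && (J.1.2 == 0%N) then (a * U) (0, 1, J.2)%N / 2 else 0.
pose q : ser F := fun J =>
  if (J.1.1 == 0%N) && (J.1.2 == 0%N) then (a * U) (0, 0, J.2)%N else 0.
have hh : hom 0 h by move=> J /negPf nJ; rewrite /h nJ.
have hq : hom 0 q by move=> J /negPf nJ; rewrite /q nJ.
have vh : vanish n.-1 h.
  move=> [[i b] c] /= hJ; rewrite /h /=; case: andP => // -[/eqP ei /eqP eb].
  rewrite serM_eq0 ?mul0r // => K M eJ.
  have hK : (mdeg K < n)%N.
    by move: (congr1 mdeg eJ) hJ; rewrite mdegD ei eb /mdeg /=; lia.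
  rewrite ea // /X; case: eqP => [eK|]; rewrite ?mul0r //.
  by move: eJ; rewrite eK => -[].
(* Below degree [n] the series [a] is [y^2], which does not divide a power of z; up to [z^n] only
   the [z^n] term of [a] times [U mzero = 1] survives. *)
have aU0 c : (c <= n)%N -> (a * U) (0, 0, c)%N =
    if c == n then a (0, 0, n)%N else 0.
  move=> hc; rewrite (serM_single (A := (0, 0, n)%N)).
    rewrite mem_mbelow /=; case: (eqVneq c n) => [->|nc].
      by rewrite leqnn /= /msub /= !subnn U0 mulr1 /mbin /= !binn mul1r.
    by rewrite leqNgt ltn_neqAle nc hc.
  move=> [[k l] m] M [] /= ek el em nK; have [dK|dK] := ltnP (mdeg (k, l, m)) n.
    rewrite ea // /X; case: eqP => [[_ e2 _]|_]; last by rewrite mul0r.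
    by rewrite e2 in el.
  case/negP: nK; rewrite !xpair_eqE; move: dK; rewrite /mdeg /=; lia.
have hh2 : hom 0 (h * h) := homM hh hh.
have lh2 c : (c <= n)%N -> (h * h) (0, 0, c)%N = 0.
  move=> hc; apply: serM_eq0 => K M eJ.
  have := congr1 mdeg eJ; rewrite mdegD {1}/mdeg /= => dJ.
  have [dK|dK] := ltnP (mdeg K) n.-1; first by rewrite vh // mul0r.
  by rewrite (vh M) ?mulr0 //; lia.
exists U, h, (q - h * h); split.
- by split=> //; apply: homD => //; apply: homN.
- by rewrite U0 oner_eq0.
- by move=> J hJ; apply: vh; apply: leq_trans hJ _; lia.
- have -> : (X F (0, 1, 0)%N + h) ^+ 2 + (q - h * h) =
      X F y2 + X F (0, 1, 0)%N * h + X F (0, 1, 0)%N * h + q.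
    by rewrite -[X F y2](X_madd F (0, 1, 0)%N (0, 1, 0)%N); ring.
  apply/funext => -[[i b] c].
  have [->|i0] := eqVneq i 0%N; last first.
    have hXh : hom 0 (X F (0, 1, 0)%N * h) by apply: (homM (@homX F (0, 1, 0)%N)).
    by rewrite !serD (homM ha hU) // (@homX F y2) // !hXh // hq // !addr0.
  rewrite !serD serXM mem_mbelow /X !xpair_eqE /=.
  (* Comparison by the power of y: exponent 0 is the choice of [q], exponent 1 that of [h], and
     higher exponents are the Weierstrass identity. *)
  case: b => [|[|b]] /=; rewrite ?add0r ?addr0 ?mul0r ?add0r /q /h /=.
  + by [].
  + by rewrite /mbin /= !bin0 /mfact /= !mul1r subn0 -splitr.
  rewrite (_ : (0, b.+2, c)%N = madd y2 (0, b, c)%N) // eU !xpair_eqE /=.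
  rewrite !mulr0 !addr0 !eqSS; case: (b == 0)%N; case: (c == 0)%N => /=;
    by rewrite ?mul1r ?mul0r.
- split=> [[[i b] c] /= nb|c hc|]; last by rewrite serD serN lh2 // subr0 /q /= aU0 // eqxx.
    rewrite serD serN /q /= (negPf nb) andbF sub0r serM_eq0 ?oppr0 //.
    move=> [[i1 b1] c1] [[i2 b2] c2] [] /= _ eb _.
    rewrite /h /=; case: (b1 =P 0%N) => [e1|]; rewrite ?andbF ?mul0r //.
    case: (b2 =P 0%N) => [e2|]; rewrite ?andbF ?mulr0 //.
    by rewrite eb e1 e2 in nb.
  by rewrite serD serN lh2 ?(ltnW hc) // subr0 /q /= aU0 ?(ltnW hc) // ltn_eqF.
Qed.

(** The parameter [n] serves both halves of the theorem: [n = 3] yields the list of normal forms,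
    while [n = k] with a nonzero coefficient at [z^k] fixes the exponent. *)
Lemma contact_normal_form a n : (2 < n)%N -> hom 0 a ->
    (forall J, (mdeg J < n)%N -> a J = X F y2 J) ->
  exists (u Y e : ser F) (c : F),
    [/\ hom 0 u /\ hom 0 Y, u mzero != 0, lead Y (0, 1, 0)%N c /\ c != 0,
        a * u = Y ^+ 2 + e &
        (a (0, 0, n)%N = 0 /\ e = 0) \/
        exists m, [/\ (2 < m)%N, e = X F (0, 0, m)%N &
                   a (0, 0, n)%N != 0 -> m = n]].
Proof.
move=> hn ha ea.
have [U [h [r [[hU hh hr] U0 vh eaU [rz rn ern]]]]] := complete_square hn ha ea.
have lY : lead (X F (0, 1, 0)%N + h) (0, 1, 0)%N 1.
  by move=> J hJ; rewrite serD vh // addr0.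
have hY : hom 0 (X F (0, 1, 0)%N + h).
  by apply: homD => //; apply: (@homX F (0, 1, 0)%N).
have [r0|] := pselect (forall c, r (0, 0, c)%N = 0).
  have e0 : r = 0.
    apply/funext => -[[i b] c]; have [->|i0] := eqVneq i 0%N; last by rewrite hr.
    by have [->|b0] := eqVneq b 0%N; [apply: r0|apply: rz]. 
  exists U, (X F (0, 1, 0)%N + h), 0, 1; split; rewrite ?oner_eq0 //.
    by rewrite eaU e0.
  by left; rewrite -ern r0.
move=> /existsNP /cid [c0 /eqP rc0].
have /ex_minnP [m rm minm] : exists c, r (0, 0, c)%N != 0 by exists c0.
have hnm : (n <= m)%N.
  by rewrite leqNgt; apply/negP => /rn e; rewrite e eqxx in rm.
pose A := (0, 0, m)%N.
(* The quotient of [r] by [z^m], read off in exponential coefficients. *)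
pose v : ser F := fun J =>
  r (madd A J) / ((mbin (madd A J) A)%:R * (mfact A)%:R).
have nz J : (mbin (madd A J) A)%:R * (mfact A)%:R != 0 :> F.
  by rewrite mulf_neq0 ?pnatr_eq0 // -lt0n ?mbin_gt0 ?mfact_gt0.
have erv : r = X F A * v.
  apply/funext => J; case: (mbelowP A J) => [[M ->]|nA].
    by rewrite serX_madd /v mulrA mulrC divfK.
  rewrite serXM; case: (mbelowP A J) => // _.
  have [i0|i0] := eqVneq J.1.1 0%N; last by rewrite hr.
  have [b0|b0] := eqVneq J.1.2 0%N; last by rewrite rz.
  have -> : J = (0, 0, J.2)%N by case: (J) i0 b0 => [[? ?] ?] /= -> ->.
  apply/eqP/negPn/negP => /minm hm; case: nA; exists (0, 0, J.2 - m)%N.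
  by case: (J) i0 b0 hm => [[? ?] ?] /= -> -> hm; rewrite /madd /= subnKC.
have hv : hom 0 v by move=> J hJ; rewrite /v hr ?mul0r.
have v0 : v mzero != 0.
  by rewrite /v mulf_neq0 ?invr_eq0 ?nz ?madd0. 
have [b [hb b0 ebv]] := inv_sqrt_exists hv v0.
exists (U * b ^+ 2), (b * (X F (0, 1, 0)%N + h)), (X F A), (b mzero).
split.
- split; first exact: homM hU (homXn (n := 2) hb).
  exact: homM hb hY.
- by rewrite serM0 expr2 serM0 !mulf_neq0.
- split=> // J hJ; rewrite (leadM (lead_unit b) lY) // mulr1.
  by rewrite /mbin /= !bin0 mul1r.
- rewrite mulrA eaU erv exprMn -[X in _ = _ + X]mulr1 -ebv; ring.
(* A nonzero coefficient of [a] at [z^n] is also that of [r], so minimality gives [m <= n], against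
   [n <= m]. *)
- by right; exists m; split=> // [|an]; [exact: leq_trans hnm
  |apply/eqP; rewrite eqn_leq hnm minm // ern].
Qed.

End NormalForm.

(** * Pairing of S(W) with power series *)

Section Linear.
Variable F : fieldType.

Lemma linext_uniq (B : choiceType) (V : lmodType F)
    (f : {linear {malg F[B]} -> V}) x : f x = linext (fun b => f << b >>) x.
Proof.
rewrite {1}[x]monalgE linear_sum; apply: eq_bigr => b _.
rewrite -linearZ /=; congr (f _).
by apply/malgP => k; rewrite mcoeffZ !mcoeffU mulr_natr.
Qed.

Definition mcoefl (B : choiceType) (b : B) (x : {malg F[B]}) : F^o := x@_b.

Fact mcoefl_is_linear (B : choiceType) (b : B) : linear (@mcoefl B b).
Proof. by move=> c x y; rewrite /mcoefl mcoeffD mcoeffZ. Qed.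

HB.instance Definition _ (B : choiceType) (b : B) :=
  GRing.isLinear.Build F {malg F[B]} F^o _ (@mcoefl B b) (mcoefl_is_linear b).

Lemma mcoeflE (B : choiceType) (b : B) (x : {malg F[B]}) :
  (mcoefl b : {linear _ -> F^o}) x = x@_b.
Proof. by []. Qed.

Local Notation S := {malg F[smon]}.
Local Notation SS := {malg F[smon2]}.
Implicit Types (f g : ser F) (x y : S).

(* S(W)^* is the algebra of power series, a series f pairing with w_J to give
   its exponential coefficient f J; the dual of a coderivation of S(W) is a
   formal vector field. *)
Definition pair f : S -> F^o := linext (fun J : smon => f (val J) : F^o).
HB.instance Definition _ f := GRing.Linear.on (pair f).

Lemma pairU f (J : smon) : pair f << J >> = f (val J).
Proof. exact: linextU. Qed.

Lemma pair_mon f J :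
  pair f (mon F J) = if ((J.1.1 <= 1) && (0 < mdeg J))%N then f J else 0.
Proof.
case: (monP F J) => [[j <- ->]|[-> /negPf ->]]; last by rewrite linear0.
by rewrite pairU (valP j).
Qed.

Lemma pairD f g x : pair (f + g) x = pair f x + pair g x.
Proof.
by rewrite -big_split; apply: eq_bigr => J _; rewrite /= serD scalerDr.
Qed.

Lemma pair_sum (s : seq midx) (G : midx -> ser F) x :
  pair (\sum_(A <- s) G A) x = \sum_(A <- s) pair (G A) x.
Proof.
elim: s => [|A s IH]; last by rewrite !big_cons pairD IH.
by rewrite !big_nil; apply: big1 => J _; rewrite ser0 scaler0.
Qed.

Lemma pair_scale (V : lmodType F) f (v : V) x :
  pair f x *: v = linext (fun J : smon => f (val J) *: v) x.
Proof. by rewrite scaler_suml; apply: eq_bigr => J _; rewrite scalerA. Qed.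

Lemma pairX (i : smon) x : pair (X F (val i)) x = (mfact (val i))%:R * x@_i.
Proof.
pose f : {linear S -> F^o} := (mfact (val i))%:R \*: mcoefl i.
apply: (@lin_ext _ _ (pair (X F (val i))) f) => J /=.
rewrite pairU /mcoefl mcoeffU /X (inj_eq val_inj).
by case: eqP => _; rewrite /GRing.scale /= ?mulr1 ?mulr0.
Qed.

Lemma tens_coef x y k m : (tens x y)@_(k, m) = x@_k * y@_m.
Proof.
have E1 i j : (tens << i >> << j >> : SS)@_(k, m) = << i >>@_k * << j >>@_m :> F.
  by rewrite tensU !mcoeffU xpair_eqE -natrM mulnb.
have E2 i : (tens << i >> y : SS)@_(k, m) = << i >>@_k * y@_m :> F.
  pose f : {linear S -> F^o} := mcoefl (k, m) \o @tens F << i >>.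
  pose g : {linear S -> F^o} := (<< i >>@_k : F) \*: mcoefl m.
  by apply: (@lin_ext _ _ f g) => j; apply: E1.
pose f : {linear S -> F^o} := mcoefl (k, m) \o tensl y.
pose g : {linear S -> F^o} := (y@_m : F) \*: mcoefl k.
rewrite [RHS]mulrC; apply: (@lin_ext _ _ f g) => i.
by rewrite [RHS]mulrC; apply: E2.
Qed.

End Linear.

(** * Parity of linear maps *)

Section Homogeneous.
Variable F : numFieldType.
Local Notation S := {malg F[smon]}.

(** The parity involution. Its eigenspaces are the homogeneous parts, so an even linear map commutes
    with it, and so does its inverse. *)
Definition parity_sign : S -> S := linext (fun J : smon => (-1) ^+ par_mon J *: << J >>).
HB.instance Definition _ := GRing.Linear.on parity_sign.

Lemma parity_sign_coef x J : (parity_sign x)@_J = (-1) ^+ par_mon J * x@_J.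
Proof.
pose f : {linear S -> F^o} := mcoefl J \o parity_sign.
pose g : {linear S -> F^o} := ((-1) ^+ par_mon J : F) \*: mcoefl J.
apply: (@lin_ext _ _ f g) => I /=.
rewrite /mcoefl /parity_sign linextU mcoeffZ !mcoeffU.
by case: eqP => [->|_]; rewrite /GRing.scale /= ?mulr0.
Qed.

Lemma homogSE p (x : S) : homogS p x <-> parity_sign x = (-1) ^+ p *: x.
Proof.
split=> [hx|e J].
  apply/malgP => J; rewrite parity_sign_coef mcoeffZ.
  have [/hx ->//|Jx] := boolP (J \in msupp x).
  by rewrite mcoeff_outdom ?mulr0.
rewrite -mcoeff_neq0 => xJ.
have := congr1 (mcoeff J) e; rewrite parity_sign_coef mcoeffZ.
move/(mulIf xJ) => /eqP; case: (par_mon J); case: p {e} => //=.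
  by rewrite expr0 expr1 eq_sym -addr_eq0 -(natrD _ 1 1) pnatr_eq0.
by rewrite expr0 expr1 -addr_eq0 -(natrD _ 1 1) pnatr_eq0.
Qed.

Lemma homogS_U J : homogS (par_mon J) (<< J >> : S).
Proof. by move=> I; rewrite msuppU oner_eq0 inE => /eqP ->. Qed.

Lemma evenmap_inv (g : {linear S -> S}) (h : S -> S) :
  cancel g h -> cancel h g -> evenmap g -> evenmap h.
Proof.
move=> gh hg eg p x /homogSE ex; apply/homogSE.
have comm y : parity_sign (g y) = g (parity_sign y).
  pose f1 : {linear S -> S} := parity_sign \o g.
  pose f2 : {linear S -> S} := g \o parity_sign.
  apply: (@lin_ext _ _ f1 f2) => J /=.
  by rewrite (proj1 (homogSE _ _) (eg _ _ (@homogS_U J))) /parity_sign linextU linearZ.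
by apply: (can_inj gh); rewrite -comm hg ex linearZ /= hg.
Qed.

End Homogeneous.

(** * Symmetry of equivalence, and invertibility of triangular maps *)

Section Equivalence.
Variable F : numFieldType.
Local Notation S := {malg F[smon]}.
Local Notation SS := {malg F[smon2]}.

Lemma tensmap_tens (f g : {linear S -> S}) x y :
  tensmap false f g (tens x y) = tens (f x) (g y).
Proof.
have E1 i j : tensmap false f g (tens << i >> << j >>) = tens (f << i >>) (g << j >>).
  by rewrite tensU /tensmap linextU scale1r.
have E2 i : tensmap false f g (tens << i >> y) = tens (f << i >>) (g y).
  pose f1 : {linear S -> SS} := tensmap false f g \o @tens F << i >>.
  pose f2 : {linear S -> SS} := @tens F (f << i >>) \o g.
  by apply: (@lin_ext _ _ f1 f2) => j; apply: E1.
pose f1 : {linear S -> SS} := tensmap false f g \o tensl y.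
pose f2 : {linear S -> SS} := tensl (g y) \o f.
by apply: (@lin_ext _ _ f1 f2) => i; apply: E2.
Qed.

Lemma comorphism_inv (g h : {linear S -> S}) :
  cancel g h -> cancel h g -> comorphism g -> comorphism h.
Proof.
move=> gh hg cg x; rewrite -{2}(hg x) cg.
pose f : {linear SS -> SS} := tensmap false h h \o tensmap false g g.
have -> t : tensmap false h h (tensmap false g g t) = t.
  rewrite -[LHS]/(f t) linext_uniq [RHS](@linext_uniq _ _ _ idfun).
  apply: eq_bigr => -[i j] _; congr (_ *: _) => /=.
  by rewrite -[X in tensmap false g g X]tensU !tensmap_tens !gh tensU.
by [].
Qed.

Lemma equivalent_sym (d d' : L F) : equivalent d d' -> equivalent d' d.
Proof.
move=> [g [h [cg eg gh hg e]]].
pose hl : {linear S -> S} :=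
  HB.pack h (GRing.isLinear.Build _ _ _ _ h (can2_linear gh hg)).
exists hl, g; split; [|exact: evenmap_inv eg|exact: hg|exact: gh|].
  exact: (@comorphism_inv g hl).
by move=> x; rewrite [RHS]/= e /= hg hg.
Qed.

(** The hypothesis says that [g] sends a monomial to a nonzero multiple of itself plus terms of
    lower degree. A top-degree monomial of [x] therefore survives in [g x], which gives injectivity;
    for surjectivity, dividing [x] by the diagonal and subtracting the image leaves a remainder of
    lower degree. *)
Lemma triangular_bij (g : {linear S -> S}) (c : midx -> F) :
    (forall I, c I != 0) ->
    (forall J I : smon, (mdeg (val J) <= mdeg (val I))%N ->
       (g << J >>)@_I = if J == I then c (val I) else 0) ->
  exists h, cancel g h /\ cancel h g.
Proof.
move=> c0 gt.
have top (f : {linear S -> S}) b x I :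
    (forall J, J \in msupp x -> (f << J >>)@_I = if J == I then b else 0) ->
    (f x)@_I = b * x@_I.
  move=> fI; pose f1 : {linear S -> F^o} := mcoefl I \o f.
  rewrite -[LHS]/(f1 x) [LHS]linext_uniq.
  pose f2 : {linear S -> F^o} := b \*: mcoefl I.
  rewrite -[RHS]/(f2 x) [RHS]linext_uniq.
  rewrite /linext big_seq [RHS]big_seq; apply: eq_bigr => J Jx.
  suff -> : f1 << J >> = f2 << J >> by [].
  rewrite /= /mcoefl fI // mcoeffU.
  by case: eqP => _; rewrite /GRing.scale /= ?mulr1 ?mulr0.
have maxdeg (x : S) : x != 0 -> exists2 I, I \in msupp x &
    forall J, J \in msupp x -> (mdeg (val J) <= mdeg (val I))%N.
  move=> x0; have [J0 J0x] : exists J, J \in msupp x.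
    apply: contrapT => nx; case/eqP: x0; apply/malgP => J; rewrite mcoeff0.
    by apply: mcoeff_outdom; apply/negP => Jx; apply: nx; exists J.
  pose j0 : msupp x := [` J0x]%fset.
  case: (@arg_maxnP _ j0 xpredT (fun i : msupp x => mdeg (val (val i)))) => // i _ mi.
  by exists (val i) => [|J Jx]; [exact: valP|exact: (mi [` Jx]%fset)].
have ginj : injective g.
  apply: raddf_inj => x gx; apply/eqP/negPn/negP => /maxdeg [I Ix mI].
  have := congr1 (mcoeff I) gx; rewrite mcoeff0 (top g (c (val I))); last first.
    by move=> J /mI; apply: gt.
  by apply/eqP; rewrite mulf_neq0 ?mcoeff_neq0.
have gsurj n : forall x : S, (forall J, J \in msupp x -> (mdeg (val J) < n)%N) ->
    exists y, g y == x.
  elim: n => [|n IH] x hx.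
    exists 0; rewrite linear0; apply/eqP/malgP => J; rewrite mcoeff0.
    by rewrite mcoeff_outdom //; apply/negP => /hx.
  pose s : {linear S -> S} := linext (fun J : smon => (c (val J))^-1 *: << J >>).
  pose gs : {linear S -> S} := g \o s.
  have [J|y /eqP ey] := IH (x - g (s x)).
    rewrite -mcoeff_neq0; apply: contraNltn => nJ; apply/eqP.
    rewrite mcoeffB -[g (s x)]/(gs x) (top gs 1) ?mul1r ?subrr // => I Ix.
    rewrite /gs /s /= linextU linearZ mcoeffZ gt; last first.
      by move: (hx _ Ix); rewrite ltnS => /leq_trans; apply.
    by case: eqP => [->|_]; rewrite ?mulVf ?mulr0.
  by exists (y + s x); rewrite linearD ey subrK.
have gsurj' (x : S) : exists y, g y == x.
  have [->|x0] := eqVneq x 0; first by exists 0; rewrite linear0.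
  by have [I _ mI] := maxdeg _ x0; apply: (gsurj (mdeg (val I)).+1) => J /mI.
exists (fun x => xchoose (gsurj' x)).
have hg x : g (xchoose (gsurj' x)) = x by apply/eqP/(xchooseP (gsurj' x)).
by split=> // x; apply: ginj; rewrite hg.
Qed.

End Equivalence.

(** * Coalgebra automorphisms as changes of variables *)

Section Substitution.
Variable F : numFieldType.
Local Notation S := {malg F[smon]}.
Local Notation SS := {malg F[smon2]}.

(** [P I] is the image of the monomial [X I] under the substitution. Prescribing a multiplicative
    family on monomials avoids composing power series; the condition on leading monomials makes the
    change of variables triangular. *)
Variables (P : midx -> ser F) (c : midx -> F).
Hypotheses (P0 : P mzero = 1) (PM : forall A B, P (madd A B) = P A * P B).
Hypotheses (Ph : forall I, hom I.1.1 (P I)).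
Hypotheses (Pl : forall I, lead (P I) I (c I)) (c0 : forall I, c I != 0).

Let natf_neq0 A : (mfact A)%:R != 0 :> F.
Proof. by rewrite pnatr_eq0 -lt0n mfact_gt0. Qed.

(* The dual of the substitution of the series P (munit j) for the variables. *)
Definition subst_map : S -> S := linext (fun J : smon =>
  \sum_(I <- mbelow (let n := mdeg (val J) in (n, n, n)))
    (P I (val J) / (mfact I)%:R) *: mon F I).
HB.instance Definition _ := GRing.Linear.on subst_map.

Lemma subst_map_coef i x :
  (subst_map x)@_i = pair (P (val i)) x / (mfact (val i))%:R.
Proof.
pose f1 : {linear S -> F^o} := mcoefl i \o subst_map.
pose f2 : {linear S -> F^o} := ((mfact (val i))%:R^-1 : F) \*: pair (P (val i)).
rewrite [RHS]mulrC; apply: (@lin_ext _ _ f1 f2) => J.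
rewrite [RHS]/= pairU [RHS]mulrC.
rewrite /f1 /= /subst_map linextU linear_sum /=.
set s := mbelow _.
have E I : mcoefl i ((P I (val J) / (mfact I)%:R) *: mon F I) =
   if I == val i then P I (val J) / (mfact I)%:R else 0.
  rewrite linearZ /= /mcoefl.
  case: (monP F I) => [[K <- ->]|[-> nI]].
    rewrite mcoeffU (inj_eq val_inj).
    by case: eqP => _; rewrite /GRing.scale /= ?mulr1 ?mulr0.
  rewrite mcoeff0 scaler0; case: eqP => // e.
  by rewrite e (valP i) in nI.
rewrite (eq_bigr _ (fun I _ => E I)).
have [si|nsi] := boolP (val i \in s).
  rewrite (bigD1_seq (val i)) ?mbelow_uniq //= eqxx big1 ?addr0 // => I.
  by move=> /negPf ->.
(* An index outside the box has larger degree than [J], and then its [P] vanishes at [J]; the finite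
   sum thus loses nothing. *)
rewrite big_seq big1 => [|I Is]; last first.
  by case: eqP => // e; rewrite -e Is in nsi.
rewrite (Pl (I := val i)); last first.
  by apply: ltnW; rewrite ltnNge; apply: contra nsi; rewrite mem_mbelow /mdeg /=; lia.
case: eqP => [e|_]; last by rewrite mul0r.
by case/negP: nsi; rewrite -e mem_mbelow /mdeg /=; lia.
Qed.

Lemma pairX_subst I x : pair (X F I) (subst_map x) = pair (P I) x.
Proof.
have [hI|] := boolP ((I.1.1 <= 1) && (0 < mdeg I))%N.
  pose i : smon := exist _ I hI.
  by rewrite -[I]/(val i) pairX subst_map_coef mulrC divfK.
(* Indices that give no basis monomial: both sides vanish, by homogeneity in theta or because S(W)
   has no degree 0 part. *)
rewrite negb_and -ltnNge -eqn0Ngt mdeg_eq0 => nI.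
have -> f : pair (X F I) f = 0.
  apply: big1 => J _; rewrite /X; case: eqP => [e|]; rewrite ?scaler0 //.
  by move: (valP J) nI; rewrite /= e -mdeg_eq0; lia.
apply/esym/big1 => J _; case/andP: (valP J) => J1 J0.
case/orP: nI => nI; first by rewrite Ph ?scaler0 // neq_ltn (leq_ltn_trans J1).
by rewrite (eqP nI) P0 ser1 -mdeg_eq0 -leqn0 leqNgt J0 scaler0.
Qed.

Lemma pair_mon_subst I K : (K.1.1 <= 1)%N -> (0 < mdeg I)%N ->
  pair (P I) (mon F K) = P I K.
Proof.
move=> hK hI; rewrite pair_mon hK /=; case: posnP => // /eqP.
rewrite mdeg_eq0 => /eqP ->; rewrite (Pl (I := I)) //.
by case: eqP => // e; rewrite -e in hI.
Qed.

(** The coproduct is dual to the multiplication of monomials; the factorials convert coordinates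
    into pairings. *)
Lemma coproduct_coef (y : S) k m :
  (mfact (val k) * mfact (val m))%:R * (coproduct y)@_(k, m) =
  pair (X F (madd (val k) (val m))) y.
Proof.
pose f1 : {linear S -> F^o} :=
  ((mfact (val k) * mfact (val m))%:R : F) \*: (mcoefl (k, m) \o @coproduct F).
apply: (@lin_ext _ _ f1 (pair (X F (madd (val k) (val m))))) => J.
rewrite -[RHS]/(pair (X F (madd (val k) (val m))) << J >>) pairU.
rewrite -[LHS]/((mfact (val k) * mfact (val m))%:R *:
  mcoefl (k, m) (coproduct << J >>)) -mon_val copr_mon; last by case/andP: (valP J).
rewrite (msum_lin (mcoefl (k, m))) (@msum_single _ _ _ (val k)) => [|K M _ nK]; last first.
  rewrite /= /mcoefl tens_coef; case: (monP F K) => [[l e ->]|[-> _]].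
    by rewrite mcoeffU (negPf (contraNneq _ nK)) ?mul0r // => <-; rewrite e.
  by rewrite mcoeff0 mul0r.
case: (mbelowP (val k) (val J)) => [[M e]|nk]; last first.
  rewrite scaler0 /X; case: eqP => // e; case: nk; by exists (val m).
rewrite e maddKl /X (inj_eq (@madd_inj _)) mcoeflE tens_coef mon_val mcoeffUU mul1r.
have -> : (mon F M)@_m = (M == val m)%:R.
  case: (monP F M) => [[l <- ->]|[-> nM]]; first by rewrite mcoeffU (inj_eq val_inj).
  by rewrite mcoeff0; case: eqP => // eM; rewrite eM (valP m) in nM.
case: eqP => [->|_]; last by rewrite /GRing.scale /= !mulr0.
by rewrite /GRing.scale /= mulr1 -natrM mulnC mfactD.
Qed.

(** Dual to the multiplicativity [PM]: at [(k, m)] both sides reduce to the product of the series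
    [P (val k)] and [P (val m)]. *)
Lemma subst_comorphism : comorphism subst_map.
Proof.
pose f1 : {linear S -> SS} := @coproduct F \o subst_map.
pose f2 : {linear S -> SS} := tensmap false subst_map subst_map \o @coproduct F.
apply: (@lin_ext _ _ f1 f2) => J; apply/malgP => -[k m].
have nz : (mfact (val k) * mfact (val m))%:R != 0 :> F.
  by rewrite natrM mulf_neq0.
apply: (mulfI nz); rewrite coproduct_coef pairX_subst pairU PM.
have hJ : ((val J).1.1 <= 1)%N by case/andP: (valP J).
rewrite /f2 /= -mon_val copr_mon // msum_lin.
rewrite -[(msum _ _)@_ _]/(mcoefl (k, m) (msum _ _)) (msum_lin (mcoefl (k, m))).
rewrite serM -[RHS](@msumZ F F^o); apply: (@eq_msum F F^o) => K hK.
have [K1 M1] : (K.1.1 <= 1)%N /\ ((msub (val J) K).1.1 <= 1)%N.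
  move: hK; rewrite mem_mbelow => /and3P [hK _ _].
  by split; [exact: leq_trans hK hJ|exact: leq_trans (leq_subr _ _) hJ].
have [k0 m0] : (0 < mdeg (val k))%N /\ (0 < mdeg (val m))%N.
  by split; [case/andP: (valP k)|case/andP: (valP m)].
have TT x y : (tensmap false subst_map subst_map : {linear SS -> SS})
    (tens x y) = tens (subst_map x) (subst_map y) by apply: tensmap_tens.
rewrite mcoeflE TT tens_coef !subst_map_coef !pair_mon_subst //.
rewrite /GRing.scale /= natrM; field.
by rewrite !natf_neq0.
Qed.

Lemma subst_evenmap : evenmap subst_map.
Proof.
move=> p x hx J; rewrite -mcoeff_neq0 subst_map_coef; apply: contraNeq => nJ.
rewrite [pair _ _]big_seq big1 ?mul0r // => K /hx pK.
rewrite Ph ?scaler0 //; apply: contra nJ => /eqP e.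
by rewrite -pK /par_mon e.
Qed.

Lemma subst_bij : exists h, cancel subst_map h /\ cancel h subst_map.
Proof.
apply: (@triangular_bij F subst_map (fun I => c I / (mfact I)%:R)) => [I|J I hJI].
  by rewrite mulf_neq0 ?invr_eq0.
rewrite subst_map_coef pairU (Pl hJI) (inj_eq val_inj).
by case: eqP => // _; rewrite mul0r.
Qed.

End Substitution.

(** * Vector fields [a d/dtheta] under changes of variables *)

Section VectorFields.
Variable F : numFieldType.
Local Notation S := {malg F[smon]}.
Local Notation e1 := (1, 0, 0)%N.

(* d is the odd vector field a(y, z) d/dtheta. *)
Definition theta_field (d : L F) (a : ser F) : Prop :=
  [/\ hom 0 a, a mzero = 0 & forall x, d x = pair a x *: delta_mx 0 0].

(** In exponential coefficients the shift by [e1] is [d/dtheta], so [f] is sent to [a df/dtheta].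
    The guard discards indices containing theta, where the derivative would read a coefficient at
    theta^2 while [w_1^2 = 0]. *)
Lemma pair_coder d a f (J : smon) : theta_field d a ->
  pair f (coder d << J >>) =
  if (val J).1.1 == 0%N then (a * (fun M => f (madd M e1))) (val J) else 0.
Proof.
case=> ha a0 ed; have hJ : ((val J).1.1 <= 1)%N by case/andP: (valP J).
rewrite -mon_val coder_mon // msum_lin.
have E K M : K \in mbelow (val J) -> M = msub (val J) K ->
    pair f (\sum_(j < 3) d (mon F K) 0 j *: mon F (madd M (munit j))) =
    if (val J).1.1 == 0%N then a K * f (madd M e1) else 0.
  move=> /[dup] /msubK eK hK eM; rewrite -eM in eK.
  have K1 : (K.1.1 <= 1)%N by move: hJ; rewrite -eK /=; lia.
  have -> : \sum_(j < 3) d (mon F K) 0 j *: mon F (madd M (munit j)) =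
      a K *: mon F (madd M e1).
    rewrite ed !big_ord_recl big_ord0 !mxE /= !mulr0 !scale0r !addr0 mulr1.
    rewrite pair_mon K1 /=; case: posnP => // /eqP.
    by rewrite mdeg_eq0 => /eqP ->; rewrite a0.
  rewrite linearZ /= pair_mon -eK /= addn_eq0.
  have -> : ((M.1.1 + 1 <= 1) && (0 < mdeg (madd M e1)))%N = (M.1.1 == 0)%N.
    by rewrite /mdeg /=; lia.
  rewrite /GRing.scale /=.
  have [eK1|nK1] := eqVneq K.1.1 0%N; first by case: ifP; rewrite /= ?mulr0.
  by rewrite ha ?mul0r.
transitivity (@msum F F^o (val J) (fun K M =>
    if (val J).1.1 == 0%N then a K * f (madd M e1) else 0)).
  by apply: (@eq_msum F F^o) => K hK; apply: E.
by case: ifP => _ //; apply: (@msum0 F F^o).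
Qed.

Lemma pairX_coder d a (I : smon) x : theta_field d a ->
  pair (X F (val I)) (coder d x) =
  if (val I).1.1 == 0%N then 0 else
    pair (a * X F (0, (val I).1.2, (val I).2)%N) x.
Proof.
move=> ha; pose f1 : {linear S -> F^o} := pair (X F (val I)) \o coder d.
have E f : (forall J : smon, (val J).1.1 = 0%N ->
      (a * (fun M => X F (val I) (madd M e1))) (val J) = f (val J)) ->
    (forall J : smon, (val J).1.1 != 0%N -> f (val J) = 0) -> f1 x = pair f x.
  move=> e0 e1; apply: (@lin_ext _ _ f1 (pair f)) => J.
  rewrite -[LHS]/(pair (X F (val I)) (coder d << J >>)) [RHS]pairU.
  by rewrite (pair_coder _ _ ha); case: eqP => [/e0|/eqP/e1].
rewrite -[LHS]/(f1 x); have [I0|I0] := eqVneq (val I).1.1 0%N.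
  transitivity (pair 0 x); last by apply: big1 => J _; rewrite scaler0.
  apply: E => // J _; apply: serM_eq0 => K M _; rewrite /X.
  case: eqP => [e|_]; last by rewrite mulr0.
  by rewrite -e /= addn1 in I0.
have eI : val I = madd e1 (0, (val I).1.2, (val I).2)%N.
  have : ((val I).1.1 <= 1)%N by case/andP: (valP I).
  by case: (val I) I0 => [[[|[|i]] b] n].
apply: E => J J0; last first.
  by case: ha => ha _ _; rewrite (homM ha (@homX F (0, _, _)%N)).
have -> // : (fun M => X F (val I) (madd M e1)) =
    X F (0, (val I).1.2, (val I).2)%N.
apply/funext => M; rewrite maddC /X {1}eI (inj_eq (@madd_inj _)).
by rewrite eI /mfact /= mul1n.
Qed.

Lemma pairX_ext (x y : S) :
  (forall i : smon, pair (X F (val i)) x = pair (X F (val i)) y) -> x = y.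
Proof.
move=> e; apply/malgP => i; have := e i; rewrite !pairX.
by apply: mulfI; rewrite pnatr_eq0 -lt0n mfact_gt0.
Qed.

(** Applied to [theta u Y^b Z^c], the field [a d/dtheta] gives [a u Y^b Z^c], which is the
    substitution applied to [a' y^b z^c] once [a u = a'(Y, Z)]. Taking [a'] as a finite sum of
    monomials, listed by [s], makes [a'(Y, Z)] a finite sum of values of [P]. *)
Lemma contact_equivalent (d d0 : L F) (a u : ser F) (P : midx -> ser F)
    (c : midx -> F) (s : seq midx) :
  P mzero = 1 -> (forall A B, P (madd A B) = P A * P B) ->
  (forall I, hom I.1.1 (P I)) -> (forall I, lead (P I) I (c I)) ->
  (forall I, c I != 0) -> P e1 = X F e1 * u -> hom 0 u ->
  theta_field d a -> theta_field d0 (\sum_(A <- s) X F A) ->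
  a * u = \sum_(A <- s) P A -> equivalent d d0.
Proof.
(* The substitution intertwines [coder d] with [coder d0] in the direction that conjugates [d0] into
   [d], hence the symmetry. *)
move=> P0 PM Ph Pl c0 Pe1 hu ha he eau; apply: equivalent_sym.
have [h [gh hg]] := subst_bij Pl c0.
exists (subst_map P), h; split=> //; [exact: (subst_comorphism P0 PM Ph Pl)|
  exact: (subst_evenmap Ph Pl)|] => x /=.
apply: (can_inj gh); rewrite hg.
pose f1 : {linear S -> S} := subst_map P \o coder d.
pose f2 : {linear S -> S} := coder d0 \o subst_map P.
apply: (@lin_ext _ _ f1 f2) => J.
rewrite -[LHS]/(subst_map P (coder d << J >>)).
rewrite -[RHS]/(coder d0 (subst_map P << J >>)).
apply: pairX_ext => I.
rewrite [LHS](pairX_subst P0 Ph Pl).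
pose I' := (0, (val I).1.2, (val I).2)%N.
rewrite (pairX_coder _ _ he) -/I' (pair_coder _ _ ha) mulr_suml.
under [in RHS]eq_bigr => A _ do rewrite X_madd.
rewrite pair_sum.
under [in RHS]eq_bigr => A _ do rewrite (pairX_subst P0 Ph Pl) PM.
rewrite -pair_sum -mulr_suml -eau pairU.
have [ha0 _ _] := ha.
have [I0|I0] := eqVneq (val I).1.1 0%N.
  case: ifP => // _; apply: serM_eq0 => K M _.
  by rewrite (Ph (val I)) ?mulr0 // I0 /= addn1.
have eI : val I = madd e1 I'.
  have : ((val I).1.1 <= 1)%N by case/andP: (valP I).
  by rewrite /I'; case: (val I) I0 => [[[|[|i]] b] n].
case: ifP => [/eqP J0|/negbT J0]; last first.
  by rewrite -mulrA (homM ha0 (homM hu (Ph I'))).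
rewrite -mulrA !serM; apply: (@eq_msum F F^o) => K _.
have : (msub (val J) K).1.1 = 0%N by rewrite /= J0.
move: (msub _ _) => M M0.
rewrite eI PM Pe1 maddC -mulrA serX_madd /mbin /mfact /= M0.
by rewrite !bin0 !mul1r.
Qed.

End VectorFields.

(** * Multiplicativity of leading monomials and cancellation *)

Section LeadingMonomials.
Variable F : numFieldType.
Implicit Types f g : ser F.

Definition leads f A := f A != 0 /\ lead f A (f A).

Lemma lead_leads f A c : c != 0 -> lead f A c -> leads f A.
Proof. by move=> c0 lf; rewrite /leads lf // eqxx. Qed.

Lemma leads1 : leads 1 mzero.
Proof. by split; [rewrite ser1 oner_eq0|exact: lead_unit]. Qed.

Lemma leadsM f g A B : leads f A -> leads g B -> leads (f * g) (madd A B).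
Proof.
move=> [f0 lf] [g0 lg]; apply: lead_leads (leadM lf lg).
by rewrite !mulf_neq0 // pnatr_eq0 -lt0n mbin_gt0.
Qed.

Lemma leadsXn f A n : leads f A -> leads (f ^+ n) (n * A.1.1, n * A.1.2, n * A.2)%N.
Proof.
move=> lf; elim: n => [|n IH]; first by rewrite expr0; apply: leads1.
by rewrite exprS !mulSn; apply: (leadsM lf IH).
Qed.

Lemma leadsX A : leads (X F A) A.
Proof.
by apply: lead_leads (@lead_X F A); rewrite pnatr_eq0 -lt0n mfact_gt0.
Qed.

(** If [g] vanishes below the degree of [J], the product at [madd A J] is a nonzero multiple of
    [g J]; induction on the degree concludes. *)
Lemma mul_lead_eq0 f g A c : c != 0 -> lead f A c -> f * g = 0 -> g = 0.
Proof.
move=> c0 lf fg0; suff vg n : vanish n g.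
  by apply/funext => J; apply: (vg (mdeg J).+1).
elim: n => // n IH J; rewrite ltnS => hJ.
have /eqP := congr1 (fun s : ser F => s (madd A J)) fg0.
rewrite (serM_lead (n := mdeg J) lf) ?mdegD //; last first.
  by move=> M hM; apply: IH; apply: leq_trans hM hJ.
rewrite mbelow_madd maddKl ser0 !mulf_eq0 (negPf c0) pnatr_eq0.
by rewrite -leqn0 leqNgt mbin_gt0 => /eqP.
Qed.

End LeadingMonomials.

(** * Codifferentials as odd vector fields of square zero *)

Section OddVectorFields.
Variable F : numFieldType.
Local Notation S := {malg F[smon]}.
Local Notation e1 := (1, 0, 0)%N.

Lemma theta_field_phi s (d : L F) :
  all (fun A => (A.1.1 == 0) && (0 < mdeg A))%N s ->
  (forall x, d x = \sum_(A <- s) phi F A 0 x) ->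
  theta_field d (\sum_(A <- s) X F A).
Proof.
move=> hs ed; have hX A : A \in s -> A.1.1 = 0%N /\ (0 < mdeg A)%N.
  by move/(allP hs) => /andP [/eqP].
split=> [J J0||x].
- elim: (s) hX => [|A r IH] hX; first by rewrite big_nil.
  rewrite big_cons serD IH; last by move=> B Br; apply: hX; rewrite inE Br orbT.
  by rewrite homX ?addr0 // (hX A _).1 ?inE ?eqxx.
- elim: (s) hX => [|A r IH] hX; first by rewrite big_nil.
  rewrite big_cons serD IH; last by move=> B Br; apply: hX; rewrite inE Br orbT.
  rewrite /X; case: eqP => [e|_]; last by rewrite addr0.
  by have [] := hX A (mem_head _ _); rewrite -e.
rewrite ed pair_sum scaler_suml; apply: eq_bigr => A _.
rewrite pair_scale; apply: (@lin_ext _ _ (phi F A 0) (linext _)) => J.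
rewrite [LHS]linextU [RHS]linextU /X.
by case: eqP => _ //; rewrite scale0r.
Qed.

(** One application of [a d/dtheta] leaves a series free of theta, as [a] is, and a second one kills
    it. *)
Lemma theta_field_codifferential d (a : ser F) :
  theta_field d a -> codifferential d.
Proof.
move=> hd; have [ha a0 ed] := hd; split=> [p x hx j|x].
  rewrite ed mxE mulf_eq0 negb_or mxE eqxx /= => /andP [ax].
  rewrite pnatr_eq0 eqb0 negbK => /eqP ->.
  case: p hx => // hx; case/eqP: ax; rewrite [pair _ _]big_seq big1 // => K /hx.
  rewrite /par_mon => oK; rewrite ha ?scaler0 //.
  by apply: contraTneq oK => ->.
rewrite /gcomm; suff -> : coder d (coder d x) = 0 by rewrite scaler0 subr0.
apply: pairX_ext => I; rewrite [RHS](linear0 (pair _)) (pairX_coder _ _ hd).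
case: ifP => // _; set f := a * _.
have hf : hom 0 f by apply: (homM ha (@homX F (0, _, _)%N)).
pose f1 : {linear S -> F^o} := pair f \o coder d.
rewrite -[LHS]/(f1 x) -[RHS]/((\0 : {linear S -> F^o}) x).
apply: lin_ext => J; rewrite -[LHS]/(pair f (coder d << J >>)).
rewrite (pair_coder _ _ hd); case: ifP => // _.
by apply: serM_eq0 => K M _; rewrite hf ?mulr0 //= addn1.
Qed.

Definition rowcoef (j : 'I_3) (v : 'rV[F]_3) : F^o := v 0 j.

Fact rowcoef_is_linear j : linear (rowcoef j).
Proof. by move=> c v w; rewrite /rowcoef !mxE. Qed.

HB.instance Definition _ j :=
  GRing.isLinear.Build F 'rV[F]_3 F^o _ (rowcoef j) (rowcoef_is_linear j).

Lemma rowcoefE j (v : 'rV[F]_3) : (rowcoef j : {linear _ -> F^o}) v = v 0 j.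
Proof. by []. Qed.

Definition theta_coef (d : L F) : ser F := fun J => d (mon F J) 0 0.

(* [d, d] = 0 gives a X = 0, where d = a d/dtheta + theta X and X is an even
   vector field; since the power series ring is a domain, X = 0. *)
Lemma codifferential_theta_field (d : L F) c A : c != 0 ->
  codifferential d -> lead (theta_coef d) A c -> theta_field d (theta_coef d).
Proof.
move=> c0 [od dd] la; set a := theta_coef d in la *.
have ha : hom 0 a.
  move=> J J0; apply/eqP/negPn/negP => /(odd_coef od) [J1].
  by have -> : J.1.1 = 1%N by lia.
have dd0 x : coder d (coder d x) = 0.
  have := dd x; rewrite /gcomm /= expr1 scaleN1r opprK => /eqP.
  rewrite -mulr2n -scaler_nat scaler_eq0 pnatr_eq0 /= => /eqP //.
(* The corestriction of the square, evaluated at a monomial free of [w_1]. There [d] takes odd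
   values, so only its [w_1] component [a] enters, and the sum is the coefficient of [a X] at
   [J]. *)
have ddJ J j : J.1.1 = 0%N ->
    msum J (fun K M => a K * d (mon F (madd M e1)) 0 j : F^o) = 0.
  move=> J0; have := coder_corestr d (coder d (mon F J)).
  rewrite dd0 linear0 coder_mon ?J0 // msum_lin.
  move/(congr1 (fun v : 'rV[F]_3 => v 0 j)); rewrite mxE => e; rewrite [RHS]e.
  rewrite -[RHS]/(rowcoef j _) (msum_lin (rowcoef j)); apply: (@eq_msum F F^o) => K hK.
  rewrite rowcoefE linear_sum summxE big_ord_recl big1 ?addr0 => [|i _].
    by rewrite linearZ mxE.
  rewrite linearZ mxE; have [->|nz] := eqVneq (d (mon F K) 0 (lift ord0 i)) 0.
    by rewrite mul0r.
  have [_] := odd_coef od nz; move: hK; rewrite mem_mbelow J0 leqn0.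
  by case/andP => /eqP ->.
have b0 J j : J.1.1 = 1%N -> d (mon F J) 0 j = 0.
  (* The component of [X] along the j-th variable. *)
  pose b : ser F := fun M => if M.1.1 == 0%N then d (mon F (madd M e1)) 0 j else 0.
  have hb : hom 0 b by move=> M /negPf M0; rewrite /b M0.
  have /(mul_lead_eq0 c0 la) eb : a * b = 0.
    apply/funext => M; have [M0|M0] := eqVneq M.1.1 0%N; last by rewrite (homM ha hb).
    rewrite ser0 -[RHS](ddJ M j M0) serM; apply: (@eq_msum F F^o) => K _.
    by rewrite /b /= M0 sub0n.
  move=> J1; have := congr1 (fun s : ser F => s (0, J.1.2, J.2)%N) eb.
  by rewrite /b /= /madd /= !addn0; case: (J) J1 => [[i k] l] /= ->.
split=> // [|x]; first by rewrite /a /theta_coef mon0 linear0 mxE.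
rewrite pair_scale; apply: (@lin_ext _ _ d (linext _)) => J.
rewrite [RHS]linextU -mon_val.
apply/rowP => j; rewrite !mxE eqxx /=.
have [J0|J0] := eqVneq (val J).1.1 0%N; last first.
  rewrite ha // mul0r b0 //.
  by apply/eqP; rewrite eqn_leq lt0n J0 andbT; case/andP: (valP J).
have [->|j0] := eqVneq j 0; first by rewrite mulr1.
rewrite mulr0; apply/eqP/negPn/negP => /(odd_coef od) [_].
by rewrite J0 /= => /eqP e; case/eqP: j0; apply: val_inj.
Qed.

End OddVectorFields.

(** * Classification of the extensions *)

Section Classification.
Variable F : numClosedFieldType.
Local Notation e1 := (1, 0, 0)%N.
Local Notation y2 := (0, 2, 0)%N.

Lemma theta_field_d_base : theta_field (d_base F) (X F y2).
Proof.
rewrite -[X F y2](big_seq1 +%R y2 (X F)).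
by apply: theta_field_phi => // x; rewrite big_seq1.
Qed.

Lemma theta_field_d_ext m : (0 < m)%N ->
  theta_field (d_ext F m) (X F y2 + X F (0, 0, m)%N).
Proof.
move=> m0; have -> : X F y2 + X F (0, 0, m)%N = \sum_(A <- [:: y2; (0, 0, m)%N]) X F A.
  by rewrite big_cons big_seq1.
apply: theta_field_phi; first by rewrite /= /mdeg /= m0.
by move=> x; rewrite big_cons big_seq1.
Qed.

Lemma equivalent_normal_form (d : L F) n : (2 < n)%N -> codifferential d ->
    (forall J, (mdeg J < n)%N -> theta_coef d J = X F y2 J) ->
  (theta_coef d (0, 0, n)%N = 0 /\ equivalent d (d_base F)) \/
  exists m, [/\ (2 < m)%N, equivalent d (d_ext F m) &
             theta_coef d (0, 0, n)%N != 0 -> m = n].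
Proof.
move=> hn cd ea; set a := theta_coef d in ea *.
have la : lead a y2 2 by move=> J hJ; rewrite ea ?(leq_ltn_trans hJ).
have hd : theta_field d a by apply: codifferential_theta_field la; rewrite ?pnatr_eq0.
have [ha _ _] := hd.
have [u [Y [e [c [[hu hY] u0 [lY c0] eau he]]]]] := contact_normal_form hn ha ea.
(* The substitution of [theta u], [Y], [z] for theta, y, z; the variable z is left unchanged. *)
pose P I : ser F := (X F e1 * u) ^+ I.1.1 * Y ^+ I.1.2 * X F (0, 0, 1)%N ^+ I.2.
have P0 : P mzero = 1 by rewrite /P !expr0 !mulr1.
have PM A B : P (madd A B) = P A * P B by rewrite /P !exprD; ring.
have hT : hom 1 (X F e1 * u) by apply: (homM (@homX F e1) hu).
have Ph I : hom I.1.1 (P I).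
  suff : hom (1 * I.1.1 + 0 * I.1.2 + 0 * I.2)%N (P I).
    by rewrite !mul0n !addn0 mul1n.
  exact: homM (homM (homXn hT) (homXn hY)) (homXn (@homX F (0, 0, 1)%N)).
have Pl I : leads (P I) I.
  have lu : leads u mzero by split=> //; apply: lead_unit.
  have lT : leads (X F e1 * u) e1 by apply: (leadsM (leadsX F e1) lu).
  have := leadsM (leadsM (leadsXn I.1.1 lT) (leadsXn I.1.2 (lead_leads c0 lY)))
    (leadsXn I.2 (leadsX F (0, 0, 1)%N)).
  rewrite /madd /= !muln0 !muln1 !addn0 !add0n.
  by case: (I) => [[]].
have Pe1 : P e1 = X F e1 * u by rewrite /P !expr0 !mulr1.
have eqv d0 s := @contact_equivalent F d d0 a u P (fun I => P I I) s P0 PM Ph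
  (fun I => (Pl I).2) (fun I => (Pl I).1) Pe1 hu hd.
have Py : P y2 = Y ^+ 2 by rewrite /P !expr0 mul1r mulr1.
case: he => [[an e0]|[m [hm em mn]]].
  left; split=> //; apply: (eqv _ [:: y2]); rewrite ?big_seq1.
    exact: theta_field_d_base.
  by rewrite eau e0 addr0.
right; exists m; split=> //; apply: (eqv _ [:: y2; (0, 0, m)%N]).
  by rewrite big_cons big_seq1; apply: theta_field_d_ext; apply: leq_trans hm.
by rewrite big_cons big_seq1 eau em Py /P !expr0 !mul1r X_expn.
Qed.

Lemma eq_theta_coef (d d' : L F) n :
  (forall J : smon, (mdeg (val J) <= n)%N -> d << J >> = d' << J >>) ->
  forall J, (mdeg J <= n)%N -> theta_coef d J = theta_coef d' J.
Proof.
move=> e J; rewrite /theta_coef; case: (monP F J) => [[K <- ->] /e ->|[-> _]] //.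
by rewrite !linear0.
Qed.

Lemma theta_coefE (d : L F) a : theta_field d a -> theta_coef d = a.
Proof.
move=> [ha a0 ed]; apply/funext => J; rewrite /theta_coef ed !mxE mulr1 pair_mon.
case: ifP => //; case: (leqP J.1.1 1) => [_|J1 _]; last first.
  by rewrite ha // neq_ltn (ltnW J1) orbT.
by move/negbT; rewrite -eqn0Ngt mdeg_eq0 => /eqP ->.
Qed.

Lemma classification :
  (forall d : L F,
     codifferential d -> leading_term 2 (d_base F) d ->
     ~ equivalent d (d_base F) ->
     exists k : nat,
       [/\ (2 < k)%N, codifferential (d_ext F k) &
           equivalent d (d_ext F k)]) /\
  (forall (k : nat) (d : L F),
     (2 < k)%N -> codifferential d -> extends_above k (d_ext F k) d ->
     equivalent d (d_ext F k)).
Proof.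
have comp n (d : L F) (J : smon) : mdeg (val J) = n -> component n d << J >> = d << J >>.
  by move=> <-; rewrite /component /= linextU eqxx.
split=> [d cd [dlt d2 _] nd|k d hk cd ek].
  (* With [n = 3] only the degrees up to 2 are prescribed, which is what the leading term
     provides. *)
  have [|[_ /nd//]|[m [hm ed _]]] := @equivalent_normal_form d 3 erefl cd.
    rewrite -(theta_coefE theta_field_d_base) => J; rewrite ltnS.
    apply: eq_theta_coef => {}J; rewrite leq_eqVlt => /orP [/eqP J2|J2].
      by rewrite -(comp _ _ _ J2) d2.
    rewrite -(comp _ _ _ erefl) dlt // /d_base [RHS]linextU.
    by case: eqP J2 => // ->.
  exists m; split; [exact: hm| |exact: ed].
  have m0 : (0 < m)%N by apply: leq_trans hm.
  exact: theta_field_codifferential (theta_field_d_ext m0).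
have k0 : (0 < k)%N by apply: leq_trans hk.
have ea J : (mdeg J <= k)%N -> theta_coef d J = X F y2 J + X F (0, 0, k)%N J.
  rewrite -serD -(theta_coefE (theta_field_d_ext k0)).
  apply: eq_theta_coef => {}J hJ; apply/eqP; rewrite -subr_eq0; apply/eqP.
  by have := ek _ hJ << J >>; rewrite comp.
(* The coefficient at [z^k] is [k!], which excludes the base codifferential and forces the exponent
   to be [k]. *)
have ak : theta_coef d (0, 0, k)%N != 0.
  by rewrite ea // /X eqxx add0r pnatr_eq0 -lt0n mfact_gt0.
have [|[e _]|[m [_ ed mk]]] := equivalent_normal_form hk cd.
- move=> J hJ; rewrite ea ?(ltnW hJ) // [X F (0, 0, k)%N J]/X.
  case: eqP => [e|_]; last by rewrite addr0.
  by rewrite e /mdeg ltnn in hJ.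
- by rewrite e eqxx in ak.
- by rewrite -(mk ak); exact: ed.
Qed.

End Classification.

Theorem mainTheorem2 (R : realType) :
  (forall d : L R[i],
     codifferential d -> leading_term 2 (d_base R[i]) d ->
     ~ equivalent d (d_base R[i]) ->
     exists k : nat,
       [/\ (2 < k)%N, codifferential (d_ext R[i] k) &
           equivalent d (d_ext R[i] k)]) /\
  (forall (k : nat) (d : L R[i]),
     (2 < k)%N -> codifferential d -> extends_above k (d_ext R[i] k) d ->
     equivalent d (d_ext R[i] k)).
Proof. exact: (@classification R[i]). Qed.
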